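(* Let $N\ge 2$, $0<s<1$ and $1<p\le\frac{N}{N-2s}$. Assume that $u\in C^{2}(\mathbb{R}^{N})\cap\overline{\mathcal{L}_{s}}$ is a nonnegative (classical, pointwise) solution of $$-\mathcal{I}u\ge u^{p}\quad\text{in }\mathbb{R}^{N}.$$ Then $u\equiv0$.
   Context: Let $e_1,\dots,e_N$ be the standard orthonormal basis of $\mathbb{R}^N$. The operator is $\mathcal{I}u=\sum_{i=1}^{N}\mathcal{I}_iu$, where $$\mathcal{I}_{i}u(x)=\frac{C_{s}}{2}\int_{\mathbb{R}}\frac{u(x+te_{i})+u(x-te_{i})-2u(x)}{|t|^{1+2s}}\,dt,\qquad C_{s}=\left(\int_{\mathbb{R}}\frac{1-\cos x}{|x|^{1+2s}}\,dx\right)^{-1}.$$ The space $\overline{\mathcal{L}_s}$ is $$\overline{\mathcal{L}_{s}}=\left\{u\in L^{1}_{loc}(\mathbb{R}^{N}):\limsup_{|x|\to+\infty}\frac{|u(x)|}{|x|^{2s-N+1-\delta_{2}}}<+\infty\text{ for some }\delta_{2}>0\right\}.$$ *)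

(* Defs.v *)
From HB Require Import structures.
From mathcomp Require Import all_boot all_order all_algebra.
From mathcomp Require Import all_classical all_reals all_analysis.

Set Implicit Arguments.
Unset Strict Implicit.
Unset Printing Implicit Defensive.

Import Order.TTheory GRing.Theory Num.Theory.
Import numFieldNormedType.Exports.

Local Open Scope classical_set_scope.
Local Open Scope ring_scope.

(** R^n is ['rV[R]_n].  The norm the library puts on it is the sup norm, so the
    Euclidean norm is defined separately. *)
Definition enorm {R : realType} {n : nat} (x : 'rV[R]_n) : R :=
  Num.sqrt (\sum_(i < n) x ord0 i ^+ 2).

Definition basis_vec {R : realType} {n : nat} (i : 'I_n) : 'rV[R]_n :=
  delta_mx ord0 i.

(** The product (equivalently, Borel) sigma-algebra on R^n. *)
Definition measure_rV_display : measure_display -> measure_display.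
Proof. exact. Qed.

Section measurable_rV.
Context {d} {T : measurableType d} (n : nat).

Let coors : 'I_n -> 'rV[T]_n -> T := fun i x => x ord0 i.

Let rV_set0 : g_sigma_preimage coors set0.
Proof. exact: sigma_algebra0. Qed.

Let rV_setC A : g_sigma_preimage coors A -> g_sigma_preimage coors (~` A).
Proof. exact: sigma_algebraC. Qed.

Let rV_bigcup (F : _^nat) : (forall i, g_sigma_preimage coors (F i)) ->
  g_sigma_preimage coors (\bigcup_i (F i)).
Proof. exact: sigma_algebra_bigcup. Qed.

HB.instance Definition _ := @isMeasurable.Build (measure_rV_display d)
  'rV[T]_n (g_sigma_preimage coors) rV_set0 rV_setC rV_bigcup.

End measurable_rV.

Lemma measurable_coord d (T : measurableType d) n (i : 'I_n) :
  measurable_fun [set: 'rV[T]_n] (fun x => x ord0 i).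
Proof.
move=> _ Y mY; rewrite setTI; apply: sub_sigma_algebra => /=.
rewrite -bigcup_seq/=; exists i => /=; first by rewrite mem_index_enum.
by exists Y => //; rewrite setTI.
Qed.

Lemma measurable_fun_coordP d1 d2 (T1 : measurableType d1)
    (T2 : measurableType d2) n (f : T1 -> 'rV[T2]_n) :
  (forall i, measurable_fun [set: T1] (fun x => f x ord0 i)) ->
  measurable_fun [set: T1] f.
Proof.
move=> mf _ A mA; rewrite setTI.
pose G := [set B : set 'rV[T2]_n | measurable (f @^-1` B)].
suff : G A by [].
apply: mA; split.
  split; rewrite /G /=.
  - by rewrite preimage_set0.
  - by move=> B mB; rewrite setTD preimage_setC; exact: measurableC.
  - by move=> F mF; rewrite preimage_bigcup; exact: bigcup_measurable.
rewrite -bigcup_seq => B /= [i _ [C mC <-]].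
by rewrite /G /= setTI -[X in measurable X]setTI; exact: mf.
Qed.

Section lebesgue_rV.
Context {R : realType}.

Definition consrV n (p : R * 'rV[R]_n) : 'rV[R]_n.+1 :=
  row_mx (p.1%:M : 'rV[R]_1) p.2.

Definition unconsrV n (x : 'rV[R]_n.+1) : R * 'rV[R]_n :=
  (x ord0 ord0, \row_i x ord0 (lift ord0 i)).

Lemma consrV0 n p : @consrV n p ord0 ord0 = p.1.
Proof.
transitivity ((row_mx (p.1%:M : 'rV_1) p.2) ord0 (lshift n ord0)).
  by rewrite /consrV; congr (fun_of_matrix _ _ _); exact/val_inj.
by rewrite row_mxEl mxE eqxx.
Qed.

Lemma consrVS n p i : @consrV n p ord0 (lift ord0 i) = p.2 ord0 i.
Proof.
transitivity ((row_mx (p.1%:M : 'rV_1) p.2) ord0 (rshift 1 i)).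
  by rewrite /consrV; congr (fun_of_matrix _ _ _); exact/val_inj.
by rewrite row_mxEr.
Qed.

Lemma consrVK n : cancel (@consrV n) (@unconsrV n).
Proof.
move=> [t x]; rewrite /unconsrV consrV0; congr pair.
by apply/rowP => i; rewrite mxE consrVS.
Qed.

Lemma measurable_consrV n : measurable_fun setT (@consrV n).
Proof.
apply: measurable_fun_coordP => i; case: (unliftP ord0 i) => [j|] ->.
  rewrite (_ : (fun _ => _) = (fun x : 'rV[R]_n => x ord0 j) \o snd).
    exact: (measurableT_comp (measurable_coord j)).
  by apply/funext => p /=; rewrite consrVS.
rewrite (_ : (fun _ => _) = fst) //.
by apply/funext => p /=; rewrite consrV0.
Qed.

Lemma measurable_unconsrV n : measurable_fun setT (@unconsrV n).
Proof.
apply: measurable_fun_pair; first exact: measurable_coord.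
apply: measurable_fun_coordP => i; under eq_fun do rewrite mxE.
exact: measurable_coord.
Qed.

Section step.
Variables (n : nat) (mu : {sigma_finite_measure set 'rV[R]_n -> \bar R}).

Definition lebesgue_cons : set 'rV[R]_n.+1 -> \bar R :=
  pushforward (@lebesgue_measure R \x mu)%E (@consrV n).

Let preim_measurable A :
  measurable A -> measurable (@consrV n @^-1` A).
Proof.
by move=> mA; rewrite -[X in measurable X]setTI; exact: measurable_consrV.
Qed.

Let lebesgue_cons0 : lebesgue_cons set0 = 0%E.
Proof. by rewrite /lebesgue_cons /pushforward preimage_set0 measure0. Qed.

Let lebesgue_cons_ge0 A : (0 <= lebesgue_cons A)%E.
Proof. by rewrite /lebesgue_cons /pushforward measure_ge0. Qed.

Let lebesgue_cons_sigma_additive : semi_sigma_additive lebesgue_cons.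
Proof.
move=> F mF tF mUF; rewrite /lebesgue_cons /pushforward preimage_bigcup.
apply: measure_semi_sigma_additive.
- by move=> k; exact: preim_measurable.
- apply/trivIsetP => /= i j _ _ ij; rewrite -preimage_setI.
  by move/trivIsetP : tF => /(_ _ _ _ _ ij) ->//; rewrite preimage_set0.
- by rewrite -preimage_bigcup; exact: preim_measurable.
Qed.

HB.instance Definition _ := isMeasure.Build _ _ _ lebesgue_cons
  lebesgue_cons0 lebesgue_cons_ge0 lebesgue_cons_sigma_additive.

Let lebesgue_consE (A : set R) (B : set 'rV[R]_n) :
  measurable A -> measurable B ->
  lebesgue_cons (@unconsrV n @^-1` (A `*` B)) = (lebesgue_measure A * mu B)%E.
Proof.
move=> mA mB; rewrite /lebesgue_cons /pushforward -comp_preimage.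
rewrite (_ : _ \o _ = id); first exact: product_measure1E.
by apply/funext => q; exact: consrVK.
Qed.

Let lebesgue_cons_sigma_finite : sigma_finite setT lebesgue_cons.
Proof.
have /sigma_finiteP[F [TF ndF Foo]] :=
  sigma_finiteT (@lebesgue_measure R : sigma_finite_measure _ _).
have /sigma_finiteP[G [TG ndG Goo]] := sigma_finiteT mu.
exists (fun k => @unconsrV n @^-1` (F k `*` G k)).
  rewrite -preimage_bigcup -(preimage_setT (@unconsrV n)); congr (_ @^-1` _).
  rewrite -setXTT TF TG predeqE => -[x y]; split.
    move=> [/= [k _ Fx] [l _ Gy]]; exists (maxn k l) => //; split.
    - by move: x Fx; exact/subsetPset/ndF/leq_maxl.
    - by move: y Gy; exact/subsetPset/ndG/leq_maxr.
  by move=> [k _ []/= ? ?]; split; exists k.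
move=> k; have [mF Fk] := Foo k; have [mG Gk] := Goo k; split.
  rewrite -[X in measurable X]setTI; apply: measurable_unconsrV => //.
  exact: measurableX.
by rewrite lebesgue_consE// lte_mul_pinfty// ge0_fin_numE.
Qed.

HB.instance Definition _ := Measure_isSigmaFinite.Build _ _ _ lebesgue_cons
  lebesgue_cons_sigma_finite.

End step.

(** N-dimensional Lebesgue measure, as an iterated product of the
    one-dimensional one. *)
Fixpoint lebesgue_rV n : {sigma_finite_measure set 'rV[R]_n -> \bar R} :=
  if n is n'.+1 then lebesgue_cons (lebesgue_rV n') else \d_(0 : 'rV[R]_0).

Lemma lebesgue_rV_box n (A : 'I_n -> set R) :
  (forall i, measurable (A i)) ->
  lebesgue_rV n [set x | forall i, A i (x ord0 i)] =
  (\prod_(i < n) lebesgue_measure (A i))%E.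
Proof.
elim: n A => [|n IH] A mA /=.
  by rewrite big_ord0 diracE mem_set //= => -[].
have mB : measurable [set x : 'rV[R]_n | forall i, A (lift ord0 i) (x ord0 i)].
  rewrite [X in measurable X](_ : _ = \bigcap_(i in [set: 'I_n])
      ((fun x : 'rV[R]_n => x ord0 i) @^-1` A (lift ord0 i))); last first.
    by apply/seteqP; split => [x + i _|x + i]; [|move=> /(_ i I)]; apply.
  apply: fin_bigcap_measurable => // i _.
  by rewrite -[X in measurable X]setTI; exact: measurable_coord.
rewrite big_ord_recl -IH// -product_measure1E//; last exact: mA.
rewrite /lebesgue_cons /pushforward.
congr (_ _); apply/seteqP; split => [[t x]|[t x]] /=.
  by move=> h; split => [|i]; [have := h ord0|have := h (lift ord0 i)];
    rewrite (consrV0, consrVS).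
by move=> [h1 h2] i; case: (unliftP ord0 i) => [j|] ->;
  rewrite (consrV0, consrVS).
Qed.

End lebesgue_rV.

Section function_spaces.
Context {R : realType} {n : nat}.
Implicit Types u : 'rV[R]_n -> R.

Fixpoint is_Ck (k : nat) u : Prop :=
  continuous u /\
  if k is k'.+1 then forall i : 'I_n,
    (forall x, derivable u x (basis_vec i)) /\ is_Ck k' ('D_(basis_vec i) u)
  else True.

Definition L1loc u : Prop :=
  measurable_fun setT u /\
  forall K : set 'rV[R]_n, compact K ->
    (\int[lebesgue_rV n]_(x in K) `|u x|%:E < +oo)%E.

(** The filter "|x| -> +oo" on R^n. *)
Definition enorm_pinfty : set_system 'rV[R]_n :=
  filter_from [set: R] (fun M => [set x | M < enorm x]).

Definition Lbar (s : R) u : Prop :=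
  L1loc u /\
  exists2 delta : R, 0 < delta &
    (limf_esup
       (fun x => (`|u x| / enorm x `^ (2 * s - n%:R + 1 - delta))%:E)
       enorm_pinfty < +oo)%E.

End function_spaces.

Section operator.
Context {R : realType}.

Definition Cs (s : R) : R :=
  (\int[lebesgue_measure]_(x in [set: R])
     ((1 - cos x) / `|x| `^ (1 + 2 * s)))^-1.

Definition Ii {n : nat} (s : R) (i : 'I_n) (u : 'rV[R]_n -> R)
    (x : 'rV[R]_n) : R :=
  Cs s / 2 *
  \int[lebesgue_measure]_(t in [set: R])
    ((u (x + t *: basis_vec i) + u (x - t *: basis_vec i) - 2 * u x)
       / `|t| `^ (1 + 2 * s)).

Definition I_op {n : nat} (s : R) (u : 'rV[R]_n -> R) (x : 'rV[R]_n) : R :=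
  \sum_(i < n) Ii s i u x.

End operator.

(* Main.v *)
Require Import Defs.
From mathcomp Require Import all_boot all_order all_algebra.
From mathcomp Require Import all_classical all_reals all_analysis.
From mathcomp Require Import measurable_realfun ring lra.

Import Order.TTheory GRing.Theory Num.Theory.
Import numFieldNormedType.Exports.

Set Implicit Arguments.
Unset Strict Implicit.
Unset Printing Implicit Defensive.

Local Open Scope classical_set_scope.
Local Open Scope ring_scope.

(** The proof is the test function method, with a test function adapted to the
    operator and with the singular kernel cut off near the origin.

    The test function.  Let b(t) = max(0, 1 - t^2)^2 and
    g_r(x) = b(x_1/r) * ... * b(x_N/r).  It has compact support and its second
    differences along a coordinate axis satisfy
    2 g_r(x) - g_r(x + t e_i) - g_r(x - t e_i) <= 8 min(1, t^2/r^2) g_r(x)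
    ([bump1_second_difference] and [cutoff_second_difference]): near the
    boundary of its support g_r is convex enough for the left-hand side to be
    nonpositive.  Integrating against |t|^(-1-2s) gives the pointwise bound
    - I g_r <= C r^(-2s) g_r, with the same compactly supported function on both
    sides.

    Integration by parts.  Individually the I_i u have no sign, and u has no
    bound on its second derivatives at infinity, so I is not moved onto g_r
    directly.  With the kernel restricted to |t| > eps everything is absolutely
    convergent on the support of g_r, and Tonelli's theorem together with
    translation invariance of Lebesgue measure moves the difference operator from
    u to g_r ([integral_truncated_operator]).  The growth condition makes the
    integrals defining I u converge, and since u is C^2 the discarded part of the
    kernel contributes at most O(eps^(2-2s)) uniformly on the support
    ([truncated_inequality]).  Letting eps tend to 0 yields
    int u^p g_r <= C r^(-2s) int u g_r  ([cutoff_energy]).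

    Conclusion.  When p <= N/(N-2s) and r >= 1, the elementary inequality
    C r^(-2s) v <= C (C/gamma)^(p-1) v^p + gamma r^(-N)  holds for all v >= 0 and
    gamma > 0 ([scaled_young]), while int g_r <= (2r)^N.  For gamma large the
    first term is absorbed and int u^p is finite ([energy_bounded]).  Then gamma
    is taken small: with a fixed cube Q, bounding u g_r by u on Q and by the
    inequality outside Q gives
    int u^p g_r <= D r^(-2s) + Gamma int_(outside Q) u^p + 2^N gamma
    ([energy_split]); r -> oo, then Q -> R^N, then gamma -> 0 shows that
    int u^p = 0, the critical exponent p = N/(N-2s) included. *)

(** * A one-dimensional bump with controlled second differences *)

Section bump.
Context {R : realType}.
Implicit Types x t : R.

Definition bump1 x : R := Num.max 0 (1 - x ^+ 2) ^+ 2.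

Lemma bump1_ge0 x : 0 <= bump1 x.
Proof. exact: sqr_ge0. Qed.

Lemma bump1_le1 x : bump1 x <= 1.
Proof.
rewrite /bump1; have [h|h] := leP (1 - x ^+ 2) 0; first by rewrite expr0n ler01.
by have := sqr_ge0 x; nra.
Qed.

Lemma bump1N x : bump1 (- x) = bump1 x.
Proof. by rewrite /bump1 sqrrN. Qed.

Lemma bump1_eq0 x : 1 <= `|x| -> bump1 x = 0.
Proof.
move=> x1; rewrite /bump1; have [h|h] := leP (1 - x ^+ 2) 0; first by rewrite expr0n.
have : `|x| ^+ 2 = x ^+ 2 by rewrite real_normK ?num_real.
nra.
Qed.

Lemma bump1_in x : 0 <= 1 - x ^+ 2 -> bump1 x = (1 - x ^+ 2) ^+ 2.
Proof. by move=> h; rewrite /bump1 (max_idPr h). Qed.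

(** Write a = 1 - x^2.  For t bounded below the term 8 min(1, t^2) b(x) alone
    dominates 2 b(x).  For small t with x + t still in the support the inequality
    is t^2 (8 a^2 - 12 a + 8) + 2 t^4 >= 0.  When x + t has left the support, x is
    close to 1 and t >= 1 - x, so that moving inward by t increases the bump by
    more than the factor 2, up to the error term. *)
Lemma bump1_second_difference_pos x t : 0 <= x -> 0 <= t ->
  2 * bump1 x <=
  bump1 (x + t) + bump1 (x - t) + 8 * Num.min 1 (t ^+ 2) * bump1 x.
Proof.
move=> x0 t0.
have b0 := bump1_ge0 x; have bp := bump1_ge0 (x + t); have bm := bump1_ge0 (x - t).
have [x1|x1] := leP 1 x.
  by rewrite (@bump1_eq0 x) ?ger0_norm// !mulr0; lra.
have [t2|t2] := leP (1 / 4) (t ^+ 2).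
  have : 1 / 4 <= Num.min 1 (t ^+ 2) by rewrite le_min t2 andbT; lra.
  move: (Num.min _ _) => k; nra.
have -> : Num.min 1 (t ^+ 2) = t ^+ 2 by apply/min_idPr; lra.
have th : t < 1 / 2 by nra.
have bx : bump1 x = (1 - x ^+ 2) ^+ 2 by apply: bump1_in; nra.
have bxm : bump1 (x - t) = (1 - (x - t) ^+ 2) ^+ 2 by apply: bump1_in; nra.
have [xt|xt] := leP (x + t) 1.
  have bxp : bump1 (x + t) = (1 - (x + t) ^+ 2) ^+ 2 by apply: bump1_in; nra.
  rewrite bx bxp bxm.
  have : 0 <= t ^+ 2 * ((1 - x ^+ 2) * (8 * (1 - x ^+ 2) - 12) + 8).
    apply: mulr_ge0; first exact: sqr_ge0.
    set a := 1 - x ^+ 2; have := sqr_ge0 (4 * a - 3); nra.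
  by have := sqr_ge0 (t ^+ 2); lra.
rewrite bx bxm.
(* 4 x (1 - x) is the value of 1 - y^2 at y = 2 x - 1 = x - (1 - x) *)
have h1 : 4 * x * (1 - x) <= 1 - (x - t) ^+ 2 by nra.
have h0 : 0 <= 4 * x * (1 - x) by nra.
have h2 : (4 * x * (1 - x)) ^+ 2 <= (1 - (x - t) ^+ 2) ^+ 2.
  by rewrite ler_sqr ?nnegrE//; lra.
have h3 : (1 - x) ^+ 2 <= t ^+ 2 by rewrite ler_sqr ?nnegrE; lra.
suff h4 : 2 * (1 - x ^+ 2) ^+ 2 <=
    (4 * x * (1 - x)) ^+ 2 + 8 * (1 - x) ^+ 2 * (1 - x ^+ 2) ^+ 2.
  have : 0 <= (1 - x ^+ 2) ^+ 2 by exact: sqr_ge0.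
  by move: h3 h4 h2 bp; set A := (1 - x) ^+ 2; set B := (1 - x ^+ 2) ^+ 2;
    set T := t ^+ 2; nra.
have -> : (4 * x * (1 - x)) ^+ 2 + 8 * (1 - x) ^+ 2 * (1 - x ^+ 2) ^+ 2 =
  2 * (1 - x ^+ 2) ^+ 2 +
  (1 - x) ^+ 2 * (16 * x ^+ 2 + 8 * ((1 - x) * (1 + x)) ^+ 2 - 2 * (1 + x) ^+ 2).
  by ring.
rewrite lerDl mulr_ge0 ?sqr_ge0//.
have xh : 1 / 2 < x by lra.
have -> : (1 - x) * (1 + x) = 1 - x ^+ 2 by ring.
have : 16 * x ^+ 2 - 2 * (1 + x) ^+ 2 = 14 * x ^+ 2 - 4 * x - 2 by ring.
have [/= hh|hh] := leP (1/2 + 1 / 8) x; have := sqr_ge0 (1 - x ^+ 2); nra.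
Qed.

Lemma bump1_second_difference x t :
  2 * bump1 x <=
  bump1 (x + t) + bump1 (x - t) + 8 * Num.min 1 (t ^+ 2) * bump1 x.
Proof.
wlog t0 : t / 0 <= t.
  move=> H; have [/H//|/ltW t0] := leP 0 t.
  have := H (- t); rewrite oppr_ge0 sqrrN opprK => /(_ t0).
  by rewrite [bump1 (x - t) + _]addrC.
wlog x0 : x / 0 <= x.
  move=> H; have [/H//|/ltW x0] := leP 0 x.
  have := H (- x); rewrite oppr_ge0 => /(_ x0).
  have -> : - x + t = - (x - t) by ring.
  have -> : - x - t = - (x + t) by ring.
  by rewrite !bump1N [bump1 (x - t) + _]addrC.
exact: bump1_second_difference_pos.
Qed.

Lemma measurable_bump1 : measurable_fun setT bump1.
Proof.
apply: measurable_funX; apply: measurable_maxr; first exact: measurable_cst.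
by apply: measurable_funB => //; exact: measurable_funX.
Qed.

Lemma bump1_half x : `|x| <= 1 / 2 -> 1 / 2 <= bump1 x.
Proof.
move=> h; have : `|x| ^+ 2 = x ^+ 2 by rewrite real_normK ?num_real.
have := normr_ge0 x => n0 e; rewrite bump1_in; nra.
Qed.

End bump.

(** * Integrals of powers on the half-line *)

Section powers.
Context {R : realType}.
Notation mu := (@lebesgue_measure R).

Lemma ge0_integral_norm (A : set R) (f : R -> \bar R) :
  measurable A -> A `<=` `]0, +oo[ -> measurable_fun setT f ->
  (forall t, (0 <= f t)%E) ->
  (\int[mu]_(t in [set t | A `|t|%R]) f `|t|%R = 2%:E * \int[mu]_(t in A) f t)%E.
Proof.
move=> mA A0 mf f0.
have Apos t : A t -> 0 < t by move=> /A0 /=; rewrite in_itv/= andbT.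
pose A' := (-%R : R -> measurableTypeR R) @^-1` A.
have mA' : measurable A'.
  by rewrite -[X in measurable X]setTI; exact: oppr_measurable.
have mfn : measurable_fun setT (fun t : R => f `|t|%R).
  by apply: measurableT_comp mf _; exact: normr_measurable.
have -> : [set t | A `|t|] = A `|` A'.
  apply/seteqP; split => [t /= At|t /= [At|At]].
  - have [t0|t0] := leP 0 t; [left|right].
      by rewrite -(ger0_norm t0).
    by rewrite /A' /= -ltr0_norm.
  - by rewrite ger0_norm// ltW// Apos.
  - by rewrite -normrN ger0_norm// ltW// Apos.
rewrite ge0_integral_setU//=; last 2 first.
- exact: measurable_funTS.
- apply/disj_setPS => t /= [/Apos t0]; rewrite /A' /= => /Apos; rewrite oppr_gt0.
  by move=> /(lt_trans t0); rewrite ltxx.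
have -> : (\int[mu]_(x in A) f `|x|%R = \int[mu]_(x in A) f x)%E.
  by apply: eq_integral => t; rewrite inE => /Apos t0; rewrite gtr0_norm.
suff -> : (\int[mu]_(x in A') f `|x|%R = \int[mu]_(x in A) f x)%E.
  by rewrite mule_natl mule2n.
transitivity (\int[pushforward mu (-%R : R -> measurableTypeR R)]_(y in A) f y)%E.
  rewrite ge0_integral_pushforward//; last exact: measurable_funTS.
  apply: eq_integral => t; rewrite inE /A' /= => /Apos t0.
  by rewrite ltr0_norm// -oppr_gt0.
by apply: eq_measure_integral => // B mB _; exact: lebesgue_measureN.
Qed.

(** Monotone convergence in the form that bounds an improper integral by a
    common bound of the proper ones. *)
Lemma integral_bigcup_le (F : (set R)^nat) (f : R -> \bar R) (M : \bar R) :
  nondecreasing_seq F -> (forall i, measurable (F i)) ->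
  (forall i, measurable_fun (F i) f) ->
  (forall t, (0 <= f t)%E) ->
  (forall i, (\int[mu]_(t in F i) f t <= M)%E) ->
  (\int[mu]_(t in \bigcup_i F i) f t <= M)%E.
Proof.
move=> ndF mF mf f0 fM.
have /cvg_lim <- // := ge0_nondecreasing_set_cvg_integral (mu := mu) ndF mF mf
  (fun i t _ => f0 t).
apply: lime_le; last by apply: nearW => i; exact: fM.
apply: ereal_nondecreasing_is_cvgn.
exact: (ge0_nondecreasing_set_nondecreasing_integral mu ndF mF mf
  (fun i t _ => f0 t)).
Qed.

Lemma derivable_powR_gt0 (b t : R) : 0 < t -> derivable (fun x => x `^ b) t 1.
Proof. by move=> t0; apply: derivable_powR; rewrite in_itv/= t0. Qed.

Lemma continuous_powR_gt0 (b t : R) : 0 < t -> {for t, continuous (fun x => x `^ b)}.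
Proof.
move=> t0; apply: differentiable_continuous; apply/derivable1_diffP.
exact: derivable_powR_gt0.
Qed.

Lemma integral_powR (k a b : R) : k != 0 -> 0 < a -> a < b ->
  (\int[mu]_(t in `[a, b]) (t `^ (k - 1))%:E = ((b `^ k - a `^ k) / k)%:E)%E.
Proof.
move=> k0 a0 ab; have b0 := lt_trans a0 ab.
rewrite (@continuous_FTC2 R (fun t => t `^ (k - 1)) (fun t => t `^ k / k) a b)//.
- by rewrite -EFinB mulrBl.
- apply/continuous_in_subspaceT => x; rewrite inE/= in_itv/= => /andP[ax _].
  exact: continuous_powR_gt0 (lt_le_trans a0 ax).
- split.
  + move=> x; rewrite in_itv/= => /andP[ax _].
    by apply: derivableM => //; exact: derivable_powR_gt0 (lt_trans a0 ax).
  + apply: cvg_at_right_filter; apply: cvgM; last exact: cvg_cst.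
    exact: continuous_powR_gt0.
  + apply: cvg_at_left_filter; apply: cvgM; last exact: cvg_cst.
    exact: continuous_powR_gt0.
- move=> x; rewrite in_itv/= => /andP[ax _].
  have x0 := lt_trans a0 ax.
  rewrite derive1Mr; last exact: derivable_powR_gt0.
  by rewrite powR_derive1 ?in_itv/= ?x0// mulrAC divff ?mul1r.
Qed.

Let mpowR (b : R) D : measurable_fun D (fun t : R => (t `^ b)%:E).
Proof. by apply/measurable_funTS/measurable_EFinP; exact: measurable_powR. Qed.

Let powR_ge0E (b t : R) : (0 <= (t `^ b)%:E)%E.
Proof. by rewrite lee_fin powR_ge0. Qed.

Lemma integral_powR_tail (c r : R) : 0 < c -> 0 < r ->
  (\int[mu]_(t in `]r, +oo[) (t `^ (- c - 1))%:E <= (r `^ (- c) / c)%:E)%E.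
Proof.
move=> c0 r0.
have -> : `]r, +oo[%classic = \bigcup_i `]r, r + i.+1%:R]%classic.
  apply/seteqP; split => [t /=|t [i _] /=]; rewrite !in_itv/=.
    rewrite andbT => rt; exists (Num.truncn (t - r)) => //=; rewrite in_itv/= rt/=.
    by rewrite -lerBlDl ltW// truncnS_gt.
  by move=> /andP[-> _].
apply: integral_bigcup_le => //.
- move=> i j ij; apply/subsetPset => t /=; rewrite !in_itv/= => /andP[-> h]/=.
  by rewrite (le_trans h)// lerD2l ler_nat ltnS.
- move=> i; rewrite integral_itv_obnd_cbnd//.
  rewrite integral_powR//; last 2 first.
    by rewrite oppr_eq0 gt_eqF.
    by rewrite ltrDl ltr0n.
  rewrite lee_fin invrN mulrN -mulNr ler_pM2r ?invr_gt0// opprB lerBlDr lerDl.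
  exact: powR_ge0.
Qed.

Lemma integral_powR_head (c r : R) : 0 < c -> 0 < r ->
  (\int[mu]_(t in `]0%R, r]) (t `^ (c - 1))%:E <= (r `^ c / c)%:E)%E.
Proof.
move=> c0 r0.
have -> : `]0, r]%classic = \bigcup_i `](r / i.+2%:R), r]%classic.
  apply/seteqP; split => [t /=|t [i _] /=]; rewrite !in_itv/=.
    move=> /andP[t0 tr]; exists (Num.truncn (r / t)) => //=.
    rewrite in_itv/= tr andbT ltr_pdivrMr// mulrC -ltr_pdivrMr//.
    by rewrite (lt_trans (truncnS_gt _))// ltr_nat.
  move=> /andP[h ->]; rewrite andbT (le_lt_trans _ h)//.
  by rewrite divr_ge0// ltW.
apply: integral_bigcup_le => //.
- move=> i j ij; apply/subsetPset => t /=; rewrite !in_itv/= => /andP[h ->].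
  rewrite andbT (le_lt_trans _ h)// ler_pM2l// lef_pV2 ?posrE ?ltr0n//.
  by rewrite ler_nat !ltnS.
- move=> i; rewrite integral_itv_obnd_cbnd//.
  rewrite integral_powR//; last 3 first.
    by rewrite gt_eqF.
    by rewrite divr_gt0 ?ltr0n.
    by rewrite ltr_pdivrMr ?ltr0n// ltr_pMr// ltr1n.
  rewrite lee_fin ler_pM2r ?invr_gt0// lerBlDr lerDl.
  exact: powR_ge0.
Qed.
End powers.

(** * Integrals of the fractional kernel *)

Section kernel.
Context {R : realType}.
Notation mu := (@lebesgue_measure R).
Variable s : R.
Hypothesis s01 : 0 < s < 1.

(** At the origin the value is 0, because 0 `^ a = 0 for a != 0 and 0^-1 = 0. *)
Definition frac_kernel (t : R) : R := (`|t| `^ (1 + 2 * s))^-1.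

Lemma frac_kernel_ge0 t : 0 <= frac_kernel t.
Proof. by rewrite invr_ge0 powR_ge0. Qed.

Lemma frac_kernelE t : frac_kernel t = `|t| `^ (- (1 + 2 * s)).
Proof. by rewrite /frac_kernel powRN. Qed.

Lemma measurable_frac_kernel D : measurable_fun D frac_kernel.
Proof.
apply: measurable_funTS; rewrite (_ : frac_kernel = (fun t => t `^ (- (1 + 2 * s))) \o Num.norm).
  by apply: measurableT_comp; [exact: measurable_powR|exact: normr_measurable].
by apply/funext => t; rewrite /= frac_kernelE.
Qed.

Let s0 : 0 < s. Proof. by case/andP: s01. Qed.
Let s1 : s < 1. Proof. by case/andP: s01. Qed.

Lemma measurable_norm_gt (r : R) : measurable [set t : R | r < `|t|].
Proof.
rewrite (_ : [set _ | _] = Num.norm @^-1` `]r, +oo[).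
  by rewrite -[X in measurable X]setTI; exact: normr_measurable.
by apply/seteqP; split => t /=; rewrite in_itv/= andbT.
Qed.

Lemma measurable_norm_le (r : R) : measurable [set t : R | `|t| <= r].
Proof.
rewrite (_ : [set _ | _] = Num.norm @^-1` `]-oo, r]).
  by rewrite -[X in measurable X]setTI; exact: normr_measurable.
by apply/seteqP; split => t /=; rewrite in_itv/=.
Qed.

Lemma frac_kernel_tail (a r : R) : a < 2 * s -> 0 < r ->
  (\int[mu]_(t in [set t | (r < `|t|)%R]) (`|t| `^ a * frac_kernel t)%:E <=
   (2 / (2 * s - a) * r `^ (a - 2 * s))%:E)%E.
Proof.
move=> as2 r0.
have -> : [set t : R | r < `|t|] = [set t | `]r, +oo[%classic `|t|].
  by apply/seteqP; split => t /=; rewrite in_itv/= andbT.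
pose f (t : R) := (t `^ (- (2 * s - a) - 1))%:E.
rewrite (@eq_integral _ (measurableTypeR R) R mu _ (fun t : R => f `|t|)); last first.
  move=> t; rewrite inE/= in_itv/= andbT => rt.
  rewrite /f frac_kernelE -powRD; last first.
    by rewrite (gt_eqF (lt_trans r0 rt)) implybT.
  by congr (_ `^ _)%:E; ring.
rewrite (ge0_integral_norm (f := f))//; last 3 first.
- by move=> t /=; rewrite !in_itv/= !andbT; exact: lt_trans.
- by apply/measurable_EFinP; exact: measurable_powR.
- by move=> t; rewrite lee_fin powR_ge0.
have := @integral_powR_tail R (2 * s - a) r.
rewrite subr_gt0 => /(_ as2 r0) h.
rewrite -mulrA EFinM; apply: lee_pmul => //.
  by apply: integral_ge0 => t _; rewrite lee_fin powR_ge0.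
by rewrite mulrC -[X in _ `^ X]opprB.
Qed.

Lemma frac_kernel_head (r : R) : 0 < r ->
  (\int[mu]_(t in [set t | (`|t| <= r)%R]) (t ^+ 2 * frac_kernel t)%:E <=
   ((1 - s)^-1 * r `^ (2 - 2 * s))%:E)%E.
Proof.
move=> r0.
have mf D : measurable_fun D (fun t : R => (t ^+ 2 * frac_kernel t)%:E).
  apply/measurable_EFinP; apply: measurable_funM; first exact: exprn_measurable.
  exact: measurable_frac_kernel.
rewrite -(@integral_setD1 _ _ 0); last 2 first.
- by apply: measurableD => //; exact: measurable_norm_le.
- exact: mf.
have -> : [set t : R | `|t| <= r] `\ 0 = [set t | `]0, r]%classic `|t|].
  apply/seteqP; split => t /=; rewrite in_itv/= normr_gt0.
    by move=> [-> /eqP ->].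
  by move=> /andP[/eqP t0 ->].
pose f (t : R) := (t `^ ((2 - 2 * s) - 1))%:E.
rewrite (@eq_integral _ (measurableTypeR R) R mu _ (fun t : R => f `|t|)); last first.
  move=> t; rewrite inE/= in_itv/= => /andP[t0 _].
  rewrite /f frac_kernelE -(real_normK (num_real t)) -powR_mulrn// -powRD; last first.
    by rewrite (gt_eqF t0) implybT.
  by congr (_ `^ _)%:E; ring.
rewrite (ge0_integral_norm (f := f))//; last 3 first.
- by move=> t /=; rewrite !in_itv/= andbT => /andP[].
- by apply/measurable_EFinP; exact: measurable_powR.
- by move=> t; rewrite lee_fin powR_ge0.
have c0 : 0 < 2 - 2 * s by rewrite subr_gt0 -[ltRHS]mulr1 ltr_pM2l.
have h := integral_powR_head c0 r0.
rewrite (_ : (1 - s)^-1 * _ = 2 * (r `^ (2 - 2 * s) / (2 - 2 * s))); last first.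
  by field; rewrite !gt_eqF// subr_gt0.
rewrite EFinM; apply: lee_pmul => //.
by apply: integral_ge0 => t _; rewrite lee_fin powR_ge0.
Qed.

Definition kernel_const : R := s^-1 + (1 - s)^-1.

Lemma kernel_const_ge0 : 0 <= kernel_const.
Proof. by rewrite addr_ge0// invr_ge0 ?subr_ge0 ltW. Qed.

(** This integral carries the order of the operator: below the scale r the factor
    (t/r)^2 makes the kernel integrable at the origin, above it the tail of the
    kernel is integrated, and both parts scale like r^(-2s). *)
Lemma frac_kernel_min (r : R) : 0 < r ->
  (\int[mu]_t (Num.min 1 ((t / r) ^+ 2) * frac_kernel t)%:E <=
   (kernel_const * r `^ (- (2 * s)))%:E)%E.
Proof.
move=> r0.
have mf D : measurable_fun D (fun t : R => (Num.min 1 ((t / r) ^+ 2) * frac_kernel t)%:E).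
  apply/measurable_EFinP; apply: measurable_funM; last exact: measurable_frac_kernel.
  apply: measurable_minr => //; apply: measurable_funX.
  exact: measurable_funM.
have f0 t : 0 <= Num.min 1 ((t / r) ^+ 2) * frac_kernel t.
  by rewrite mulr_ge0 ?frac_kernel_ge0// le_min ler01 sqr_ge0.
have -> : setT = [set t : R | r < `|t|] `|` [set t | `|t| <= r].
  apply/seteqP; split => t //= _.
  by have [|] := leP `|t| r; [right|left].
rewrite (ge0_integral_setU mu (measurable_norm_gt r) (measurable_norm_le r))//=; last 3 first.
- exact: mf.
- by move=> t _; rewrite lee_fin.
- by apply/disj_setPS => t /= [h]; rewrite leNgt h.
rewrite /kernel_const mulrDl EFinD; apply: leeD.
  apply: (le_trans (y := \int[mu]_(t in [set t | (r < `|t|)%R])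
      (`|t| `^ 0 * frac_kernel t)%:E)%E).
    apply: ge0_le_integral => //=.
    - exact: measurable_norm_gt.
    - by move=> t _; rewrite lee_fin.
    - exact: mf.
    - apply/measurable_EFinP; apply: measurable_funM; last exact: measurable_frac_kernel.
      rewrite (_ : (fun t : R => _) = cst 1); first exact: measurable_cst.
      by apply/funext => t; rewrite powRr0.
    - move=> t _; rewrite lee_fin powRr0; apply: ler_wpM2r; first exact: frac_kernel_ge0.
      by rewrite ge_min lexx.
  have s2 : 0 < 2 * s by rewrite mulr_gt0.
  apply: (le_trans (frac_kernel_tail s2 r0)); rewrite lee_fin sub0r subr0.
  rewrite (_ : 2 / (2 * s) = s^-1)//; first by field; rewrite gt_eqF.
apply: (le_trans (y := \int[mu]_(t in [set t | (`|t| <= r)%R])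
      ((r ^- 2)%:E * (t ^+ 2 * frac_kernel t)%:E))%E).
  apply: ge0_le_integral => //=.
  - exact: measurable_norm_le.
  - by move=> t _; rewrite lee_fin.
  - exact: mf.
  - apply/measurable_EFinP; apply: measurable_funM => //.
    by apply: measurable_funM; [exact: exprn_measurable|exact: measurable_frac_kernel].
  - move=> t _; rewrite -EFinM lee_fin mulrA; apply: ler_wpM2r; first exact: frac_kernel_ge0.
    by rewrite ge_min exprMn exprVn [X in _ || (X <= _)]mulrC lexx orbT.
rewrite ge0_integralZl_EFin//; last 4 first.
- exact: measurable_norm_le.
- by move=> t _; rewrite lee_fin mulr_ge0 ?sqr_ge0 ?frac_kernel_ge0.
- apply/measurable_EFinP.
  by apply: measurable_funM; [exact: exprn_measurable|exact: measurable_frac_kernel].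
- by rewrite invr_ge0 sqr_ge0.
apply: (le_trans (lee_wpmul2l _ (frac_kernel_head r0))).
  by rewrite lee_fin invr_ge0 sqr_ge0.
rewrite -EFinM lee_fin powRD; last by rewrite (gt_eqF r0) implybT.
rewrite powR_mulrn ?(ltW r0)// mulrCA [X in _ * X <= _]mulrA mulVf ?mul1r//.
by rewrite sqrf_eq0 gt_eqF.
Qed.

End kernel.

(** * Translation invariance in R^N *)

Section translation.
Context {R : realType}.
Notation mu := (@lebesgue_measure R).

Lemma ge0_integral_translation (c : R) (f : R -> \bar R) :
  measurable_fun setT f -> (forall t, (0 <= f t)%E) ->
  (\int[mu]_t f (t + c)%R = \int[mu]_t f t)%E.
Proof.
move=> mf f0.
pose tr : measurableTypeR R -> measurableTypeR R := fun t : R => t + c.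
have mtr : measurable_fun setT tr by apply: measurable_funD.
transitivity (\int[pushforward mu tr]_t f t)%E.
  by rewrite ge0_integral_pushforward.
apply: eq_measure_integral => // A mA _; apply/esym/lebesgue_measure_unique => //=.
move=> _ [[a b]] _ <-; rewrite /pushforward /=.
rewrite (_ : _ @^-1` _ = `]a - c, b - c]%classic); last first.
  by apply/seteqP; split => t /=; rewrite !in_itv/= ltrBlDr lerBrDr.
rewrite /= !lebesgue_measure_itv/= !lte_fin ltrD2r -!EFinB.
by rewrite (_ : b - c - (a - c) = b - a)//; ring.
Qed.

(** N-dimensional Lebesgue measure is built as the image of a product under
    [consrV], hence this form of Tonelli's theorem, on which inductions on the
    dimension rest. *)
Lemma ge0_integral_rV_cons n (f : 'rV[R]_n.+1 -> \bar R) :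
  measurable_fun setT f -> (forall x, (0 <= f x)%E) ->
  (\int[lebesgue_rV n.+1]_x f x =
   \int[mu]_t \int[lebesgue_rV n]_y f (consrV (t, y)))%E.
Proof.
move=> mf f0.
have mfc : measurable_fun setT (f \o @consrV R n).
  by apply: measurableT_comp mf _; exact: measurable_consrV.
rewrite -(fubini_tonelli1 (m1 := mu) (m2 := lebesgue_rV n) (f \o @consrV R n))//;
  last by move=> z; exact: f0.
have := @ge0_integral_pushforward _ _ (measurableTypeR R * 'rV[R]_n)%type
  'rV[R]_n.+1 R (@consrV R n) (@measurable_consrV R n)
  (mu \x lebesgue_rV n)%E setT f measurableT mf (fun x _ => f0 x).
rewrite preimage_setT => <-.
by apply: eq_measure_integral => [|? A mA _ //]; exact: measurable_consrV.
Qed.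

Lemma translate_basisE n (i k : 'I_n) (c : R) (x : 'rV[R]_n) :
  (x + c *: basis_vec i) ord0 k = x ord0 k + c * (k == i)%:R.
Proof. by rewrite !mxE. Qed.

Lemma measurable_translate_basis n (i : 'I_n) d (T : measurableType d)
    (g : T -> 'rV[R]_n) (h : T -> R) :
  measurable_fun setT g -> measurable_fun setT h ->
  measurable_fun setT (fun z => g z + h z *: basis_vec i).
Proof.
move=> mg mh; apply: measurable_fun_coordP => j.
rewrite (_ : (fun _ => _) =
    (fun z => g z ord0 j + h z * basis_vec i ord0 j)); last first.
  by apply/funext => z; rewrite !mxE.
apply: measurable_funD; last by apply: measurable_funM.
exact: (measurableT_comp (measurable_coord j)).
Qed.

Lemma ge0_integral_rV_translation n (i : 'I_n) (c : R) (f : 'rV[R]_n -> \bar R) :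
  measurable_fun setT f -> (forall x, (0 <= f x)%E) ->
  (\int[lebesgue_rV n]_x f (x + c *: basis_vec i)%R =
   \int[lebesgue_rV n]_x f x)%E.
Proof.
elim: n i f => [[]//|n IH] i f mf f0.
have mfc : measurable_fun setT (fun x : 'rV[R]_n.+1 => f (x + c *: basis_vec i)).
  by apply: measurableT_comp mf _; apply: measurable_translate_basis.
rewrite !ge0_integral_rV_cons//.
have mfcons : measurable_fun setT (f \o @consrV R n).
  by apply: measurableT_comp mf _; exact: measurable_consrV.
case: (unliftP ord0 i) => [j|] ->.
  apply: eq_integral => t _.
  rewrite -(IH j (fun y => f (consrV (t, y))))//; last first.
    exact: (measurableT_comp mfcons (pair1_measurable t)).
  apply: eq_integral => y _; congr f; apply/rowP => k.
  rewrite translate_basisE; case: (unliftP ord0 k) => [l|] ->.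
    by rewrite !consrVS translate_basisE (inj_eq lift_inj).
  by rewrite !consrV0 /= mulr0 addr0.
pose F t := (\int[lebesgue_rV n]_y f (consrV (t, y)))%E.
rewrite -[RHS](@ge0_integral_translation c F); last 2 first.
- apply: (measurable_fun_fubini_tonelli_F (m2 := lebesgue_rV n) (f \o @consrV R n)).
    exact: mfcons.
  by move=> z; exact: f0.
- by move=> t; apply: integral_ge0 => y _; exact: f0.
apply: eq_integral => t _; apply: eq_integral => y _; congr f; apply/rowP => k.
rewrite translate_basisE; case: (unliftP ord0 k) => [l|] ->.
  by rewrite !consrVS /= mulr0 addr0.
by rewrite !consrV0 eqxx mulr1.
Qed.

Lemma ge0_integral_shift_adjoint n (i : 'I_n) (c : R) (f g : 'rV[R]_n -> R) :
  measurable_fun setT f -> measurable_fun setT g ->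
  (forall x, 0 <= f x) -> (forall x, 0 <= g x) ->
  (\int[lebesgue_rV n]_x (f x * g (x + c *: basis_vec i)%R)%:E =
   \int[lebesgue_rV n]_x (f (x - c *: basis_vec i)%R * g x)%:E)%E.
Proof.
move=> mf mg f0 g0.
rewrite -[RHS](ge0_integral_rV_translation i c).
- by apply: eq_integral => x _; rewrite addrK.
- apply/measurable_EFinP; apply: measurable_funM => //.
  apply: measurableT_comp mf _.
  by under eq_fun do rewrite -scaleNr; exact: measurable_translate_basis.
- by move=> x; rewrite lee_fin mulr_ge0.
Qed.

End translation.

(** * Moving the truncated operator onto the test function *)

Section duality.
Context {R : realType} {n : nat}.
Notation mu := (@lebesgue_measure R).
Notation L := (@lebesgue_rV R n).
Variables (i : 'I_n) (f g : 'rV[R]_n -> R).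
Hypotheses (mf : measurable_fun setT f) (mg : measurable_fun setT g).
Hypotheses (f0 : forall x, 0 <= f x) (g0 : forall x, 0 <= g x).

Let e : 'rV[R]_n := basis_vec i.

Lemma measurable_translate (h : 'rV[R]_n -> R) (t : R) :
  measurable_fun setT h -> measurable_fun setT (fun x : 'rV[R]_n => h (x + t *: e)).
Proof.
by move=> mh; apply: measurableT_comp mh _; exact: measurable_translate_basis.
Qed.

Lemma measurable_line (h : 'rV[R]_n -> R) (x : 'rV[R]_n) :
  measurable_fun setT h -> measurable_fun setT (fun t : R => h (x + t *: e)).
Proof.
by move=> mh; apply: measurableT_comp mh _; exact: measurable_translate_basis.
Qed.

Lemma measurable_lineN (h : 'rV[R]_n -> R) (x : 'rV[R]_n) :
  measurable_fun setT h -> measurable_fun setT (fun t : R => h (x - t *: e)).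
Proof.
move=> mh; under eq_fun do rewrite -scaleNr.
apply: measurableT_comp mh _.
by apply: measurable_translate_basis => //; exact: oppr_measurable.
Qed.

Lemma measurable_translate_pair (h : 'rV[R]_n -> R) :
  measurable_fun setT h ->
  measurable_fun setT (fun z : 'rV[R]_n * R => h (z.1 + z.2 *: e)).
Proof.
by move=> mh; apply: measurableT_comp mh _; exact: measurable_translate_basis.
Qed.

Lemma measurable_translate_pairN (h : 'rV[R]_n -> R) :
  measurable_fun setT h ->
  measurable_fun setT (fun z : 'rV[R]_n * R => h (z.1 - z.2 *: e)).
Proof.
move=> mh; under eq_fun do rewrite -scaleNr.
apply: measurableT_comp mh _.
apply: measurable_translate_basis => //.
by apply: measurableT_comp measurable_snd; exact: oppr_measurable.
Qed.

(** Translation invariance moves both translates from f to g; the second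
    difference inequality for g then holds under the integral sign.  Everything
    is written without subtraction, so that no finiteness is involved. *)
Lemma integral_second_difference (c t : R) : 0 <= c ->
  (forall x, 2 * g x <= g (x + t *: e) + g (x - t *: e) + c * g x) ->
  (\int[L]_x (g x * (2 * f x))%:E <=
   \int[L]_x (g x * (f (x + t *: e) + f (x - t *: e)))%:E +
   c%:E * \int[L]_x (f x * g x)%:E)%E.
Proof.
move=> c0 h.
have mfp := measurable_translate t mf.
have mgp := measurable_translate t mg.
have mfm : measurable_fun setT (fun x : 'rV[R]_n => f (x - t *: e)).
  by under eq_fun do rewrite -scaleNr; exact: measurable_translate.
have mgm : measurable_fun setT (fun x : 'rV[R]_n => g (x - t *: e)).
  by under eq_fun do rewrite -scaleNr; exact: measurable_translate.
have -> : (\int[L]_x (g x * (f (x + t *: e) + f (x - t *: e)))%:E =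
  \int[L]_x (g (x - t *: e) * f x)%:E + \int[L]_x (g (x + t *: e) * f x)%:E)%E.
  rewrite -(ge0_integral_shift_adjoint i t mg mf g0 f0).
  have := ge0_integral_shift_adjoint i (- t) mg mf g0 f0.
  under [X in _ = X -> _]eq_integral do rewrite scaleNr opprK.
  move=> <-.
  rewrite -ge0_integralD//=.
  - by apply: eq_integral => x _; rewrite -EFinD -mulrDr scaleNr.
  - by move=> x _; rewrite lee_fin mulr_ge0.
  - by apply/measurable_EFinP; exact: measurable_funM.
  - by move=> x _; rewrite lee_fin mulr_ge0.
  - by apply/measurable_EFinP; apply: measurable_funM => //; exact: measurable_translate.
rewrite -ge0_integralZl_EFin//; last 2 first.
- by move=> x _; rewrite lee_fin mulr_ge0.
- by apply/measurable_EFinP; exact: measurable_funM.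
have m1 : measurable_fun setT (fun x : 'rV[R]_n => (g (x - t *: e) * f x)%:E).
  by apply/measurable_EFinP; exact: measurable_funM.
have m2 : measurable_fun setT (fun x : 'rV[R]_n => (g (x + t *: e) * f x)%:E).
  by apply/measurable_EFinP; exact: measurable_funM.
have m3 : measurable_fun setT (fun x : 'rV[R]_n => (c%:E * (f x * g x)%:E)%E).
  apply/measurable_EFinP; apply: measurable_funM => //.
  exact: measurable_funM.
have p1 x : (0 <= (g (x - t *: e) * f x)%:E)%E by rewrite lee_fin mulr_ge0.
have p2 x : (0 <= (g (x + t *: e) * f x)%:E)%E by rewrite lee_fin mulr_ge0.
have p3 x : (0 <= (c%:E * (f x * g x)%:E))%E by rewrite lee_fin !mulr_ge0.
rewrite -ge0_integralD// -ge0_integralD//; last 2 first.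
- by move=> x _; rewrite adde_ge0.
- exact: emeasurable_funD.
apply: ge0_le_integral => //.
- by move=> x _; rewrite lee_fin !mulr_ge0.
- by apply/measurable_EFinP; apply: measurable_funM => //; exact: measurable_funM.
- by apply: emeasurable_funD => //; exact: emeasurable_funD.
- move=> x _; rewrite -EFinM -!EFinD lee_fin.
  have := ler_wpM2r (f0 x) (h x); rewrite !mulrDl; lra.
Qed.

(** For an integrable kernel k this says that the integral of g times the
    k-difference operator applied to -f is at most the integral of f g times
    int c k: Tonelli's theorem reduces it to a fixed step t, which is
    [integral_second_difference]. *)
Lemma integral_truncated_operator (k : R -> R) (c : R -> R) :
  measurable_fun setT k -> (forall t, 0 <= k t) ->
  measurable_fun setT c -> (forall t, 0 <= c t) ->
  (forall t x, 2 * g x <= g (x + t *: e) + g (x - t *: e) + c t * g x) ->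
  (\int[L]_x \int[mu]_t (g x * (2 * f x * k t))%:E <=
   \int[L]_x \int[mu]_t (g x * ((f (x + t *: e) + f (x - t *: e)) * k t))%:E +
   (\int[mu]_t (c t * k t)%:E) * \int[L]_x (f x * g x)%:E)%E.
Proof.
move=> mk k0 mc c0 h.
pose F1 := fun z : 'rV[R]_n * R => (g z.1 * (2 * f z.1 * k z.2))%:E.
pose F2 := fun z : 'rV[R]_n * R =>
  (g z.1 * ((f (z.1 + z.2 *: e) + f (z.1 - z.2 *: e)) * k z.2))%:E.
have mg1 : measurable_fun setT (fun z : 'rV[R]_n * R => g z.1).
  exact: measurableT_comp mg measurable_fst.
have mf1 : measurable_fun setT (fun z : 'rV[R]_n * R => f z.1).
  exact: measurableT_comp mf measurable_fst.
have mk2 : measurable_fun setT (fun z : 'rV[R]_n * R => k z.2).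
  exact: measurableT_comp mk measurable_snd.
have mF1 : measurable_fun setT F1.
  apply/measurable_EFinP; apply: measurable_funM => //.
  by apply: measurable_funM => //; apply: measurable_funM.
have mF2 : measurable_fun setT F2.
  apply/measurable_EFinP; apply: measurable_funM => //.
  apply: measurable_funM => //; apply: measurable_funD.
    exact: measurable_translate_pair.
  exact: measurable_translate_pairN.
have F10 z : (0 <= F1 z)%E by rewrite lee_fin !mulr_ge0.
have F20 z : (0 <= F2 z)%E.
  by rewrite lee_fin !mulr_ge0 ?addr_ge0.
rewrite (fubini_tonelli (m1 := L) (m2 := mu) F1)//.
rewrite (fubini_tonelli (m1 := L) (m2 := mu) F2)//.
have mG2 : measurable_fun setT (fun t => \int[L]_x F2 (x, t))%E.
  exact: (measurable_fun_fubini_tonelli_G (m1 := L)).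
set H := (\int[L]_x (f x * g x)%:E)%E.
have H0 : (0 <= H)%E by apply: integral_ge0 => x _; rewrite lee_fin mulr_ge0.
have mck : measurable_fun setT (fun t => (c t * k t)%:E).
  by apply/measurable_EFinP; exact: measurable_funM.
rewrite -ge0_integralZr//; last by move=> t _; rewrite lee_fin mulr_ge0.
rewrite -ge0_integralD//; last 3 first.
- by move=> t _; apply: integral_ge0 => x _; exact: F20.
- by move=> t _; rewrite mule_ge0// lee_fin mulr_ge0.
- by apply: emeasurable_funM.
apply: ge0_le_integral => //.
- by move=> t _; apply: integral_ge0 => x _; exact: F10.
- exact: (measurable_fun_fubini_tonelli_G (m1 := L)).
- by apply: emeasurable_funD => //; exact: emeasurable_funM.
move=> t _.
have sumk (q : 'rV[R]_n -> R) : measurable_fun setT q -> (forall x, 0 <= q x) ->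
   (\int[L]_x (q x * k t)%:E = (k t)%:E * \int[L]_x (q x)%:E)%E.
  move=> mq q0; under eq_integral do rewrite mulrC EFinM.
  rewrite ge0_integralZl_EFin//; first by move=> x _; rewrite lee_fin.
  exact/measurable_EFinP.
have -> : (\int[L]_x F1 (x, t) = (k t)%:E * \int[L]_x (g x * (2 * f x))%:E)%E.
  rewrite -sumk.
  - by apply: eq_integral => x _; rewrite /F1 /= mulrA.
  - by apply: measurable_funM => //; exact: measurable_funM.
  - by move=> x; rewrite !mulr_ge0.
have -> : (\int[L]_x F2 (x, t) =
   (k t)%:E * \int[L]_x (g x * (f (x + t *: e) + f (x - t *: e)))%:E)%E.
  rewrite -sumk.
  - by apply: eq_integral => x _; rewrite /F2 /= mulrA.
  - apply: measurable_funM => //; apply: measurable_funD.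
      exact: measurable_translate.
    by under eq_fun do rewrite -scaleNr; exact: measurable_translate.
  - by move=> x; rewrite mulr_ge0// addr_ge0.
apply: (le_trans (lee_wpmul2l _ (integral_second_difference (c0 t) (h t)))).
  by rewrite lee_fin.
rewrite ge0_muleDr; last 2 first.
- by apply: integral_ge0 => x _; rewrite lee_fin mulr_ge0// addr_ge0.
- by rewrite mule_ge0// lee_fin.
by rewrite muleA -EFinM [k t * _]mulrC.
Qed.

End duality.

(** * Truncating the singular integral on a line *)

Section truncation.
Context {R : realType}.
Notation mu := (@lebesgue_measure R).
Variable s : R.
Hypothesis s01 : 0 < s < 1.

Definition tkernel (eps t : R) : R := if eps < `|t| then frac_kernel s t else 0.

Lemma tkernel_ge0 eps t : 0 <= tkernel eps t.
Proof. by rewrite /tkernel; case: ifP => // _; exact: frac_kernel_ge0. Qed.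

Lemma tkernel_le eps t : tkernel eps t <= frac_kernel s t.
Proof. by rewrite /tkernel; case: ifP => // _; exact: frac_kernel_ge0. Qed.

Lemma tkernelE eps : tkernel eps = frac_kernel s \_ [set t | eps < `|t|].
Proof.
apply/funext => t; rewrite /tkernel patchE; case: ifPn => h.
  by rewrite mem_set.
by rewrite memNset//; exact/negP.
Qed.

Lemma measurable_tkernel eps : measurable_fun setT (tkernel eps).
Proof.
rewrite tkernelE; apply/(measurable_restrictT _ (measurable_norm_gt eps)).
exact: measurable_frac_kernel.
Qed.

Variables (phi : R -> R) (c C M a eps : R).
Hypothesis mphi : measurable_fun setT phi.
Hypothesis phi0 : forall t, 0 <= phi t.
Hypothesis c0 : 0 <= c.
Hypothesis as2 : a < 2 * s.
Hypothesis phi_near : forall t, `|t| <= 1 -> `|phi t - c| <= C * t ^+ 2.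
Hypothesis phi_far : forall t, 1 < `|t| -> phi t <= M * `|t| `^ a.
Hypothesis eps01 : 0 < eps <= 1.

Let D (t : R) : R := (phi t - c) * frac_kernel s t.
Let E := [set t : R | eps < `|t|].

Let mgt (r : R) : measurable ([set t : R | r < `|t|] : set (measurableTypeR R)).
Proof. exact: measurable_norm_gt. Qed.

Let mle (r : R) : measurable ([set t : R | `|t| <= r] : set (measurableTypeR R)).
Proof. exact: measurable_norm_le. Qed.

Let mE : measurable (E : set (measurableTypeR R)). Proof. exact: mgt. Qed.

Let mD A : measurable_fun A D.
Proof.
apply: measurable_funTS; apply: measurable_funM; last exact: measurable_frac_kernel.
exact: measurable_funB.
Qed.

Let mnD A : measurable_fun A (fun t : R => `|D t|).
Proof.
by move=> mA; apply: measurableT_comp (mA); [exact: normr_measurable|exact: mD].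
Qed.

Let mED A : measurable_fun A (EFin \o D).
Proof. by apply/measurable_EFinP; exact: mD. Qed.

Let eps0 : 0 < eps. Proof. by case/andP: eps01. Qed.
Let eps1 : eps <= 1. Proof. by case/andP: eps01. Qed.
Let s0 : 0 < s. Proof. by case/andP: s01. Qed.
Let s20 : 0 < 2 * s. Proof. by rewrite mulr_gt0. Qed.

Let C0 : 0 <= C.
Proof.
have /phi_near : `|1 : R| <= 1 by rewrite normr1.
by rewrite expr1n mulr1; apply: le_trans.
Qed.

Lemma integral_near_bound (r : R) : 0 < r -> r <= 1 ->
  (\int[mu]_(t in [set t | (`|t| <= r)%R]) `|D t|%:E <=
   (C / (1 - s) * r `^ (2 - 2 * s))%:E)%E.
Proof.
move=> r0 r1.
have mk A : measurable_fun A (fun t : R => t ^+ 2 * frac_kernel s t).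
  by apply: measurable_funM; [exact: exprn_measurable|exact: measurable_frac_kernel].
apply: (@le_trans _ _ (\int[mu]_(t in [set t | (`|t| <= r)%R])
    (C%:E * (t ^+ 2 * frac_kernel s t)%:E))%E).
  apply: ge0_le_integral => //.
  - apply/measurable_EFinP.
    exact: mnD.
  - by apply/measurable_EFinP; apply: measurable_funM => //; exact: mk.
  - move=> t /= tr; rewrite -EFinM lee_fin normrM mulrA.
    rewrite [X in _ * X <= _]ger0_norm ?frac_kernel_ge0//.
    apply: ler_wpM2r; first exact: frac_kernel_ge0.
    exact: (phi_near (le_trans tr r1)).
rewrite ge0_integralZl_EFin//; last 2 first.
- by move=> t _; rewrite lee_fin mulr_ge0 ?sqr_ge0 ?frac_kernel_ge0.
- by apply/measurable_EFinP; exact: mk.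
by rewrite -mulrA EFinM lee_wpmul2l// ?lee_fin//; exact: frac_kernel_head.
Qed.

Lemma integrable_kernel_tail (r b : R) : 0 < r -> b < 2 * s ->
  mu.-integrable [set t | r < `|t|] (EFin \o (fun t : R => `|t| `^ b * frac_kernel s t)).
Proof.
move=> r0 b2; apply/integrableP; split.
  apply/measurable_EFinP; apply: measurable_funM; last exact: measurable_frac_kernel.
  rewrite (_ : (fun t : R => _) = (fun t => t `^ b) \o Num.norm)//.
  apply: measurable_funTS; apply: measurableT_comp; first exact: measurable_powR.
  exact: normr_measurable.
apply: (@le_lt_trans _ _ (\int[mu]_(t in [set t | (r < `|t|)%R])
    (`|t| `^ b * frac_kernel s t)%:E)%E).
  rewrite le_eqVlt; apply/orP; left; apply/eqP; apply: eq_integral => t _ /=.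
  by rewrite ger0_norm// mulr_ge0 ?powR_ge0 ?frac_kernel_ge0.
by apply: (le_lt_trans (frac_kernel_tail b2 r0)); rewrite ltry.
Qed.

(** The real-valued integral is 0 by convention on non-integrable functions, so
    integrability is what gives its value in the definition of the operator a
    meaning: the quadratic bound handles the singularity, the growth bound with
    a < 2s the tail. *)
Lemma integrable_second_difference : mu.-integrable setT (EFin \o D).
Proof.
rewrite (_ : setT = [set t : R | `|t| <= 1] `|` [set t | 1 < `|t|]); last first.
  by apply/seteqP; split => t //= _; have [|] := leP `|t| 1; [left|right].
have i1 : mu.-integrable [set t : R | `|t| <= 1] (EFin \o D).
  apply/integrableP; split; first exact: mED.
  by apply: (le_lt_trans (integral_near_bound ltr01 (lexx 1))); rewrite ltry.
have i2 : mu.-integrable [set t : R | 1 < `|t|] (EFin \o D).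
  have ia := integrable_kernel_tail ltr01 as2.
  have i0 := integrable_kernel_tail ltr01 s20.
  have /(integrableD (mgt 1)) :=
    integrableZl (mgt 1) M ia.
  move=> /(_ _ (integrableZl (mgt 1) c i0)).
  apply: le_integrable; first exact: mgt.
    exact: mED.
  move=> t /= t1; rewrite lee_fin powRr0 mul1r.
  apply: le_trans (ler_norm _).
  rewrite /D normrM [X in _ * X <= _]ger0_norm ?frac_kernel_ge0//.
  rewrite mulrA -mulrDl ler_wpM2r ?frac_kernel_ge0//.
  apply: (le_trans (ler_normB _ _)); rewrite ger0_norm// (ger0_norm c0) lerD2r.
  exact: phi_far.
have : mu.-integrable ([set t : R | `|t| <= 1] `|` [set t | 1 < `|t|]) (EFin \o D).
  apply/integrableP; split; first exact: mED.
  rewrite (ge0_integral_setU mu (mle 1) (mgt 1))//.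
  - by rewrite lte_add_pinfty//; [case/integrableP: i1|case/integrableP: i2].
  - by apply: measurableT_comp => //; exact: mED.
  - by apply/disj_setPS => t /= []; rewrite leNgt => /negP.
by [].
Qed.

Let integrable_cst_tail : mu.-integrable E (EFin \o (fun t => c * frac_kernel s t)).
Proof.
have := integrableZl mE c (integrable_kernel_tail eps0 s20).
apply: eq_integrable => // t _ /=.
by rewrite powRr0 mul1r.
Qed.

Let integrable_D A : measurable A -> mu.-integrable A (EFin \o D).
Proof. by move=> mA; apply: integrableS integrable_second_difference. Qed.

Let integrable_phi_tail : mu.-integrable E (EFin \o (fun t => phi t * frac_kernel s t)).
Proof.
have := integrableD mE (integrable_D mE) integrable_cst_tail.
apply: eq_integrable => // t _ /=.
by rewrite -EFinD /D -mulrDl subrK.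
Qed.

Let mulr_tkernel (h : R -> R) :
  (fun t => h t * tkernel eps t) = (fun t => h t * frac_kernel s t) \_ E.
Proof.
apply/funext => t; rewrite tkernelE !patchE; case: ifP => // _.
by rewrite mulr0.
Qed.

Lemma integrable_phi_tkernel :
  mu.-integrable setT (EFin \o (fun t => phi t * tkernel eps t)).
Proof.
rewrite mulr_tkernel -restrict_EFin.
by apply/integrable_restrict => //; rewrite setTI.
Qed.

Lemma integrable_cst_tkernel :
  mu.-integrable setT (EFin \o (fun t => c * tkernel eps t)).
Proof.
rewrite (mulr_tkernel (fun=> c)) -restrict_EFin.
by apply/integrable_restrict => //; rewrite setTI.
Qed.

(** The two sides of the truncation: beyond eps the constant c can be integrated
    separately against the kernel, while the part within eps is an error of order
    eps^(2-2s), by the quadratic bound on phi - c. *)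
Lemma truncated_operator_le :
  \int[mu]_t (phi t * tkernel eps t) <=
  \int[mu]_t (c * tkernel eps t) + \int[mu]_t ((phi t - c) * frac_kernel s t) +
  C / (1 - s) * eps `^ (2 - 2 * s).
Proof.
rewrite mulr_tkernel (mulr_tkernel (fun=> c)) -!Rintegral_mkcond.
have split : \int[mu]_t D t =
    \int[mu]_(t in [set t | `|t| <= eps]) D t + \int[mu]_(t in E) D t.
  rewrite -Rintegral_setU//.
  - congr Rintegral; apply/seteqP; split => t //= _.
    by have [|] := leP `|t| eps; [left|right].
  - by apply: integrable_D; apply: measurableU => //; exact: mle.
  - by apply/disj_setPS => t /= []; rewrite /E /= leNgt => /negP.
have near_le : - (C / (1 - s) * eps `^ (2 - 2 * s)) <=
    \int[mu]_(t in [set t | `|t| <= eps]) D t.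
  rewrite lerNl; apply: (le_trans (ler_norm _)); rewrite normrN.
  have iD := integrable_D (mle eps).
  apply: (le_trans (le_normr_Rintegral (mle eps) iD)).
  have b := integral_near_bound eps0 eps1.
  rewrite -lee_fin fineK// ge0_fin_numE; last exact: integral_ge0.
  by apply: (le_lt_trans b); rewrite ltry.
have tail : \int[mu]_(t in E) (phi t * frac_kernel s t) =
    \int[mu]_(t in E) D t + \int[mu]_(t in E) (c * frac_kernel s t).
  rewrite -RintegralD//; last exact: integrable_D.
  by apply: eq_Rintegral => t _; rewrite /D -mulrDl subrK.
rewrite tail; move: split near_le; rewrite /D; lra.
Qed.

End truncation.

(** * Bounds on cubes and growth along coordinate lines *)

Section growth.
Context {R : realType} {n : nat}.
Implicit Types (u : 'rV[R]_n -> R) (x : 'rV[R]_n).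

(** Cubes rather than Euclidean balls: they are products of intervals, which
    makes them compact and gives their Lebesgue measure, and they are the supports
    of product test functions. *)
Definition cube (r : R) : set 'rV[R]_n := [set x | forall j, `|x ord0 j| <= r].

Lemma cube_compact r : compact (cube r).
Proof.
have -> : cube r = [set x | forall j, `[- r, r]%classic (x ord0 j)].
  by apply/seteqP; split => x xr j; have := xr j; rewrite /= in_itv/= ler_norml.
exact: (rV_compact (fun=> @segment_compact R (- r) r)).
Qed.

Lemma cube_bounded u r : continuous u -> exists2 B, 0 <= B &
  forall x, cube r x -> `|u x| <= B.
Proof.
move=> cu.
have [[x0 x0r]|cube0] := pselect (cube r !=set0); last first.
  by exists 0 => // x xr; exfalso; apply: cube0; exists x.
have [|c _ h] := @EVT_max_rV R n (fun x => `|u x|) _ (ex_intro _ x0 x0r) (@cube_compact r).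
  apply: continuous_subspaceT => x.
  by apply: (continuous_comp (cu x)); exact: norm_continuous.
by exists `|u c| => // x xr; apply: h; rewrite inE.
Qed.

Lemma enorm_le_cube m x : cube m x -> enorm x <= n%:R * m.
Proof.
rewrite /cube/=; case: n x => [|k] x xm.
  by rewrite /enorm big_ord0 sqrtr0 mul0r.
have m0 : 0 <= m by apply: le_trans (xm ord0).
rewrite -(@ger0_norm _ (k.+1%:R * m)) ?mulr_ge0// -sqrtr_sqr ler_wsqrtr//.
apply: (@le_trans _ _ (\sum_(i < k.+1) m ^+ 2)).
  apply: ler_sum => j _; rewrite -real_normK ?num_real//.
  by rewrite lerXn2r ?nnegrE//; exact: xm.
rewrite sumr_const card_ord exprMn -[leLHS]mulr_natl ler_wpM2r ?sqr_ge0//.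
by rewrite expr2 ler_peMr// ler1n.
Qed.

Lemma cube_enorm x : cube (enorm x) x.
Proof.
move=> j; rewrite -sqrtr_sqr ler_wsqrtr// (bigD1 j)//= lerDl.
by apply: sumr_ge0 => i _; exact: sqr_ge0.
Qed.

Lemma enorm_ge0 x : 0 <= enorm x.
Proof. exact: sqrtr_ge0. Qed.

Lemma limf_esup_bound (f : 'rV[R]_n -> R) :
  (limf_esup (fun x => (f x)%:E) enorm_pinfty < +oo)%E ->
  exists M K : R, forall x, M < enorm x -> f x <= K.
Proof.
rewrite limf_esupE => /ereal_inf_lt [_ [V [M _ MV] <-] supV].
exists M; case: (ereal_sup _) supV (@ereal_sup_ubound R ((fun x => (f x)%:E) @` V))
  => [K| |] // _ ub.
- by exists K => x /MV Vx; rewrite -lee_fin; apply: ub; exists x.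
- exists 0 => x /MV Vx.
  by have := ub (f x)%:E; rewrite leeNy_eq => /(_ (ex_intro2 _ _ x Vx erefl)).
Qed.

(** The exponent b = 2s - n + 1 - delta of the growth condition is below 2s as
    n >= 1.  It may be negative; max(0, b) serves as exponent so that the bound is
    also correct on the bounded region where only continuity is available. *)
Lemma Lbar_growth s u : (0 < n)%N -> 0 < s -> continuous u -> Lbar s u ->
  exists a A, [/\ 0 <= a, a < 2 * s, 0 <= A &
    forall x, u x <= A * (1 + enorm x) `^ a].
Proof.
move=> n0 s0 cu [_ [delta d0 /limf_esup_bound[M0 [K hK]]]].
set b := 2 * s - n%:R + 1 - delta in hK.
have n1 : 1 <= n%:R :> R by rewrite ler1n.
have b2 : b < 2 * s by rewrite /b; lra.
pose a := Num.max 0 b.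
have a0 : 0 <= a by rewrite le_max lexx.
have ba : b <= a by rewrite le_max lexx orbT.
have [B B0 hB] := cube_bounded (Num.max M0 1) cu.
exists a, (B + Num.max 0 K); split => //.
- by rewrite gt_max b2 mulr_gt0.
- by rewrite addr_ge0// le_max lexx.
move=> x; have x0 := enorm_ge0 x.
have P0 : 1 <= (1 + enorm x) `^ a.
  by rewrite -[leLHS](powRr0 (1 + enorm x)) ler_powR// lerDl.
have K0 : 0 <= Num.max 0 K by rewrite le_max lexx.
have [xM|xM] := leP (enorm x) (Num.max M0 1).
  have : u x <= B.
    apply: le_trans (ler_norm _) _; apply: hB => j.
    exact: le_trans (cube_enorm x j) xM.
  move: P0 K0 B0; set P := _ `^ _; set k := Num.max _ _; nra.
move: xM; rewrite gt_max => /andP[xM x1].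
have e0 : 0 < enorm x by apply: lt_trans x1.
have := hK _ xM; rewrite ler_pdivrMr ?powR_gt0// => uK.
apply: (le_trans (ler_norm _)); apply: (le_trans uK).
apply: (@le_trans _ _ (Num.max 0 K * enorm x `^ b)).
  by rewrite ler_wpM2r ?powR_ge0// le_max lexx orbT.
apply: (@le_trans _ _ (Num.max 0 K * (1 + enorm x) `^ a)).
  rewrite ler_wpM2l//; apply: (@le_trans _ _ (enorm x `^ a)).
    by rewrite ler_powR// ltW.
  by rewrite ge0_ler_powR ?nnegrE// ?addr_ge0// lerDr.
by rewrite ler_wpM2r ?powR_ge0// lerDr.
Qed.

Lemma cube_translate (i : 'I_n) r x t : cube r x ->
  cube (r + `|t|) (x + t *: basis_vec i).
Proof.
move=> xr j; rewrite translate_basisE; apply: (le_trans (ler_normD _ _)).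
apply: lerD; first exact: xr.
by rewrite normrM; case: eqP => _; rewrite ?normr1 ?mulr1// normr0 mulr0.
Qed.

(** On a line through a point of a fixed cube the growth is that of |t|^a, with a
    constant uniform over the cube. *)
Lemma line_growth u a A r (i : 'I_n) : 0 <= r -> 0 <= a -> 0 <= A ->
  (forall x, u x <= A * (1 + enorm x) `^ a) ->
  forall x t, cube r x -> 1 < `|t| ->
    u (x + t *: basis_vec i) <= A * (1 + n%:R * (r + 1)) `^ a * `|t| `^ a.
Proof.
move=> r0 a0 A0 h x t xr t1; apply: (le_trans (h _)); rewrite -mulrA.
apply: ler_wpM2l => //.
have m0 : 0 <= 1 + n%:R * (r + 1) by rewrite addr_ge0// mulr_ge0// addr_ge0.
rewrite -powRM// ge0_ler_powR ?nnegrE//.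
- by rewrite addr_ge0// enorm_ge0.
- by rewrite mulr_ge0.
have := enorm_le_cube (cube_translate i t xr).
have n0 : 0 <= n%:R :> R by [].
move: (n%:R : R) n0 => N N0 le1.
have : 0 <= N * r by rewrite mulr_ge0.
have : N * r * 1 <= N * r * `|t| by rewrite ler_wpM2l ?mulr_ge0// ltW.
move: le1; set E := enorm _; set T := `|t| in t1 *; lra.
Qed.

End growth.

(** * Second differences of C^2 functions *)

Section second_difference.
Context {R : realType} {n : nat}.
Implicit Types (u : 'rV[R]_n -> R) (x e : 'rV[R]_n).

Lemma is_derive_line u x e t : derivable u (x + t *: e) e ->
  is_derive t 1 (fun t : R => u (x + t *: e)) ('D_e u (x + t *: e)).
Proof.
move=> du.
have E : (fun h : R => h^-1 *: (((fun t : R => u (x + t *: e)) \o shift t) (h *: 1)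
    - u (x + t *: e))) =
  (fun h : R => h^-1 *: ((u \o shift (x + t *: e)) (h *: e) - u (x + t *: e))).
  apply/funext => h /=; congr (_ *: (u _ - _)).
  by rewrite -[h *: 1]/(h * 1) mulr1 scalerDl addrCA.
by split; rewrite /derivable /derive E.
Qed.

(** The mean value theorem is applied to z |-> v z + v (- z) between 0 and t, and
    then to v1 between - c and c, where c is the point found first. *)
Lemma second_difference_le (v v1 v2 : R -> R) (t M : R) :
  (forall t : R, is_derive t 1 v (v1 t)) -> (forall t : R, is_derive t 1 v1 (v2 t)) ->
  (forall z, `|z| <= `|t| -> `|v2 z| <= M) ->
  `|v t + v (- t) - 2 * v 0| <= 2 * M * t ^+ 2.
Proof.
move=> dv dv1 hM.
wlog t0 : t hM / 0 <= t.
  move=> H; have [/(H _ hM)//|/ltW t0] := leP 0 t.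
  have := H (- t); rewrite oppr_ge0 normrN opprK sqrrN => /(_ hM t0).
  by rewrite [v (- t) + _]addrC.
move: t0; rewrite le_eqVlt => /predU1P[<-|t0].
  by rewrite oppr0 expr0n mulr0 -mulr2n mulr_natl subrr normr0.
have M0 : 0 <= M by apply: le_trans (hM 0 _); rewrite ?normr0.
have cv1 : continuous v1.
  by move=> z; apply: differentiable_continuous; apply/derivable1_diffP; case: (dv1 z).
have dN (z : R) : is_derive z 1 (fun z : R => v (- z)) (- v1 (- z)).
  have := @is_derive1_comp R v -%R z (v1 (- z)) (- 1) (dv _).
  by rewrite mulrN1; apply; apply: is_deriveN.
have dh (z : R) : is_derive z 1 (fun z : R => v z + v (- z)) (v1 z - v1 (- z)).
  exact: is_deriveD.
have [|c] := MVT t0 (fun z _ => dh z).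
  apply: continuous_subspaceT => z; apply: differentiable_continuous.
  by apply/derivable1_diffP; case: (dh z).
rewrite in_itv/= => /andP[c0 ct].
rewrite subr0 oppr0 => Ec.
have cc : - c < c by lra.
have [|d] := MVT cc (fun z _ => dv1 z).
  exact: continuous_subspaceT.
rewrite in_itv/= => /andP[d0 dc] Ed.
have -> : v t + v (- t) - 2 * v 0 = v2 d * (2 * c) * t.
  by (transitivity (v t + v (- t) - (v 0 + v 0)); [ring | rewrite Ec Ed; ring]).
have : `|v2 d| <= M by apply: hM; rewrite (gtr0_norm t0) ler_norml; lra.
rewrite !normrM (gtr0_norm t0) (gtr0_norm c0) normr_nat => h.
have h1 : `|v2 d| * (2 * c) <= M * (2 * c) by rewrite ler_wpM2r//; lra.
have h2 : M * (2 * c) <= M * (2 * t) by rewrite ler_wpM2l//; lra.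
rewrite (_ : 2 * M * t ^+ 2 = M * (2 * t) * t); last by ring.
by rewrite ler_wpM2r ?(ltW t0)//; lra.
Qed.

Lemma C2_second_difference u r : is_Ck 2 u ->
  exists C, forall (i : 'I_n) x t, cube r x -> `|t| <= 1 ->
    `|u (x + t *: basis_vec i) + u (x - t *: basis_vec i) - 2 * u x| <= C * t ^+ 2.
Proof.
move=> [cu H].
have HB (i : 'I_n) : exists B, forall x, cube (r + 1) x ->
    `|'D_(basis_vec i) ('D_(basis_vec i) u) x| <= B.
  have [_ [_ /(_ i) [_ [c2 _]]]] := H i.
  by have [B _ hB] := cube_bounded (r + 1) c2; exists B.
have [B hB] := choice HB.
exists (2 * \sum_i `|B i|) => i x t xr t1.
set e : 'rV[R]_n := basis_vec i.
have [d1 [_ /(_ i) [d2 _]]] := H i.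
pose v (t : R) := u (x + t *: e).
have := @second_difference_le v (fun t => 'D_e u (x + t *: e))
  (fun t => 'D_e ('D_e u) (x + t *: e)) t (\sum_i `|B i|).
rewrite /v scale0r addr0 scaleNr; apply.
- by move=> z; exact: is_derive_line.
- by move=> z; exact: is_derive_line.
- move=> z zt; apply: (@le_trans _ _ (B i)).
    apply: hB => j; apply: (le_trans (cube_translate i z xr j)).
    by rewrite lerD2l; apply: le_trans t1.
  rewrite (bigD1 i)//=; apply: (le_trans (ler_norm _)); rewrite lerDl.
  by apply: sumr_ge0.
Qed.

End second_difference.

(** * The truncated differential inequality *)

Section truncated_inequality.
Context {R : realType}.

Lemma powR_small (q b K delta : R) : 0 < q -> 0 < b -> 0 < delta ->
  exists2 eps : R, 0 < eps <= b & K * eps `^ q <= delta.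
Proof.
move=> q0 b0 d0.
(* eps is chosen through its power eps^q = y *)
pose y : R := Num.min (b `^ q) (delta / (`|K| + 1)).
have K1 : 0 < `|K| + 1 by rewrite ltr_wpDl.
have y0 : 0 < y by rewrite lt_min powR_gt0 ?divr_gt0.
have yb : y <= b `^ q by rewrite ge_min lexx.
exists (y `^ q^-1).
  rewrite powR_gt0//=; apply: (@le_trans _ _ ((b `^ q) `^ q^-1)).
    by apply: ge0_ler_powR; rewrite ?nnegrE ?powR_ge0 ?invr_ge0// ltW.
  by rewrite -powRrM mulfV ?gt_eqF// powRr1 ?(ltW b0).
rewrite -powRrM mulVf ?gt_eqF// powRr1 ?(ltW y0)//.
apply: (@le_trans _ _ ((`|K| + 1) * y)).
  by rewrite ler_wpM2r ?(ltW y0)// (le_trans (ler_norm K))// lerDl.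
have : y <= delta / (`|K| + 1) by rewrite ge_min lexx orbT.
by rewrite ler_pdivlMr// mulrC.
Qed.

Lemma Cs_ge0 (s : R) : 0 <= Cs s.
Proof.
rewrite invr_ge0; apply: Rintegral_ge0 => x _.
by rewrite divr_ge0 ?powR_ge0// subr_ge0 cos_le1.
Qed.

Variables (n : nat) (s p : R) (u : 'rV[R]_n -> R).
Hypothesis n0 : (0 < n)%N.
Hypothesis s01 : 0 < s < 1.
Hypothesis u2 : is_Ck 2 u.
Hypothesis uL : Lbar s u.
Hypothesis u0 : forall x, 0 <= u x.
Hypothesis uI : forall x, u x `^ p <= - I_op s u x.
Notation mu := (@lebesgue_measure R).

(** The inequality u^p <= - I u with the kernel restricted to |t| > eps, at the
    price of an error delta that is uniform over a cube: the neglected part of the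
    kernel only sees the second differences of u near the cube, which are O(t^2).
    The negative part of the operator is moved to the left-hand side, so that both
    sides are sums of nonnegative integrals and can be integrated in x by Tonelli's
    theorem. *)
Lemma truncated_inequality (r delta : R) : 0 <= r -> 0 < delta ->
  exists eps : R, 0 < eps <= 1 /\ forall x, cube r x ->
  ((u x `^ p)%:E + (Cs s / 2)%:E * \sum_(i < n)
     \int[mu]_t ((u (x + t *: basis_vec i) + u (x - t *: basis_vec i))
                 * tkernel s eps t)%:E <=
   (Cs s / 2)%:E * \sum_(i < n) \int[mu]_t (2 * u x * tkernel s eps t)%:E
   + delta%:E)%E.
Proof.
move=> r0 d0; have [s0 s1] := andP s01.
have cu : continuous u by case: u2.
have measurable_u : measurable_fun setT u by case: uL => -[].
have [a [A [a0 a2 A0 uA]]] := Lbar_growth n0 s0 cu uL.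
have [C hC] := C2_second_difference r u2.
have q0 : 0 < 2 - 2 * s by rewrite subr_gt0 -[ltRHS]mulr1 ltr_pM2l.
have [eps eps01 heps] := powR_small (Cs s / 2 * n%:R * (C / (1 - s))) q0 ltr01 d0.
exists eps; split => // x xr.
pose phi (i : 'I_n) (t : R) := u (x + t *: basis_vec i) + u (x - t *: basis_vec i).
pose M := 2 * (A * (1 + n%:R * (r + 1)) `^ a).
have mphi i : measurable_fun setT (phi i).
  by apply: measurable_funD; [exact: measurable_line|exact: measurable_lineN].
have phi0 i t : 0 <= phi i t by rewrite addr_ge0.
have c0 : 0 <= 2 * u x by rewrite mulr_ge0.
have near i t : `|t| <= 1 -> `|phi i t - 2 * u x| <= C * t ^+ 2 by exact: hC.
have far i t : 1 < `|t| -> phi i t <= M * `|t| `^ a.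
  move=> t1; rewrite /M -mulrA mulr_natl mulr2n; apply: lerD.
    exact: (line_growth i r0 a0 A0 uA xr t1).
  by rewrite -scaleNr -[`|t|]normrN (line_growth i r0 a0 A0 uA xr)// normrN.
have iphi i := integrable_phi_tkernel s01 (mphi i) (phi0 i) c0 a2 (near i) (far i) eps01.
have icst (i : 'I_n) := integrable_cst_tkernel s01 (2 * u x) eps01.
have le i := truncated_operator_le s01 (mphi i) (phi0 i) c0 a2 (near i) (far i) eps01.
have EX : (\sum_(i < n) \int[mu]_t (phi i t * tkernel s eps t)%:E =
   (\sum_(i < n) \int[mu]_t (phi i t * tkernel s eps t))%:E)%E.
  rewrite -sumEFin; apply: eq_bigr => i _; rewrite fineK//.
  exact: integrable_fin_num (iphi i).
have EY : (\sum_(i < n) \int[mu]_t (2 * u x * tkernel s eps t)%:E =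
   (\sum_(i < n) \int[mu]_t (2 * u x * tkernel s eps t))%:E)%E.
  rewrite -sumEFin; apply: eq_bigr => i _; rewrite fineK//.
  exact: integrable_fin_num (icst i).
rewrite EX EY -!EFinM -!EFinD lee_fin.
have := uI x; rewrite /I_op /Ii -mulr_sumr => upx.
have Cs0 : 0 <= Cs s / 2 by rewrite divr_ge0// Cs_ge0.
have : \sum_(i < n) \int[mu]_t (phi i t * tkernel s eps t) <=
   \sum_(i < n) \int[mu]_t (2 * u x * tkernel s eps t) +
   \sum_(i < n) \int[mu]_t ((phi i t - 2 * u x) * frac_kernel s t) +
   \sum_(i < n) (C / (1 - s) * eps `^ (2 - 2 * s)).
  by rewrite -!big_split /=; apply: ler_sum => i _; exact: le.
have -> : \sum_(i < n) (C / (1 - s) * eps `^ (2 - 2 * s)) =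
    n%:R * (C / (1 - s) * eps `^ (2 - 2 * s)).
  by rewrite sumr_const card_ord [RHS]mulr_natl.
move=> /(ler_wpM2l Cs0).
rewrite !mulrDr => sum_le.
have comb (U I X Y E d : R) :
    U <= - I -> X <= Y + I + E -> E <= d -> U + X <= Y + d.
  move=> h1 h2 h3; apply: (le_trans (lerD h1 h2)).
  by rewrite [Y + I + E]addrAC [- I + _]addrC addrK lerD2l.
apply: comb upx sum_le _; apply: le_trans heps.
by rewrite !mulrA.
Qed.

End truncated_inequality.

(** * The test function on R^N *)

Section cutoff.
Context {R : realType} {n : nat}.
Implicit Types (x : 'rV[R]_n) (r t : R).

Definition cutoff r x : R := \prod_(j < n) bump1 (x ord0 j / r).

Lemma cutoff_ge0 r x : 0 <= cutoff r x.
Proof. by apply: prodr_ge0 => j _; exact: bump1_ge0. Qed.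

Lemma cutoff_le1 r x : cutoff r x <= 1.
Proof. by apply: prodr_ile1 => j; rewrite bump1_ge0 bump1_le1. Qed.

Lemma cutoff_eq0 r x : 0 < r -> ~ cube r x -> cutoff r x = 0.
Proof.
move=> r0 /existsNP[j /negP]; rewrite -ltNge => rx.
rewrite /cutoff (bigD1 j)//= bump1_eq0 ?mul0r//.
by rewrite normrM normfV (gtr0_norm r0) ler_pdivlMr// mul1r ltW.
Qed.

Lemma cutoff_half r x : 0 < r -> cube (r / 2) x -> (1 / 2) ^+ n <= cutoff r x.
Proof.
move=> r0 xr; rewrite -[n in leLHS]card_ord -prodr_const.
apply: ler_prod => j _; rewrite divr_ge0//=; apply: bump1_half.
rewrite normrM normfV (gtr0_norm r0) ler_pdivrMr// mulrAC mul1r mulrC.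
by rewrite mulrC; exact: xr.
Qed.

Lemma measurable_cutoff r : measurable_fun setT (cutoff r).
Proof.
apply: measurable_prod => j _; apply: measurableT_comp measurable_bump1 _.
by apply: measurable_funM => //; exact: measurable_coord.
Qed.

(** A translation along the i-th axis changes only the i-th factor of the
    product, so the one-dimensional inequality can be multiplied by the others. *)
Lemma cutoff_second_difference r (i : 'I_n) t x :
  2 * cutoff r x <=
  cutoff r (x + t *: basis_vec i) + cutoff r (x - t *: basis_vec i) +
  8 * Num.min 1 ((t / r) ^+ 2) * cutoff r x.
Proof.
pose P := \prod_(j < n | j != i) bump1 (x ord0 j / r).
have E c : cutoff r (x + c *: basis_vec i) = bump1 (x ord0 i / r + c / r) * P.
  rewrite /cutoff (bigD1 i)//= translate_basisE eqxx mulr1 mulrDl; congr (_ * _).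
  apply: eq_bigr => j ji; rewrite translate_basisE.
  by rewrite (negbTE ji) mulr0 addr0.
have E0 : cutoff r x = bump1 (x ord0 i / r) * P by rewrite /cutoff (bigD1 i).
rewrite -scaleNr !E E0 mulNr.
have P0 : 0 <= P by apply: prodr_ge0 => j _; exact: bump1_ge0.
have := ler_wpM2r P0 (bump1_second_difference (x ord0 i / r) (t / r)).
by rewrite !mulrDl !mulrA.
Qed.

Lemma measurable_cube r : measurable (cube r : set 'rV[R]_n).
Proof.
rewrite [X in measurable X](_ : _ = \bigcap_(i in [set: 'I_n])
    ((fun x : 'rV[R]_n => x ord0 i) @^-1` `[- r, r])); last first.
  apply/seteqP; split => x xr; first by move=> i _ /=; rewrite in_itv/= -ler_norml.
  by move=> i; have := xr i I; rewrite /= in_itv/= -ler_norml.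
apply: fin_bigcap_measurable => // i _.
by rewrite -[X in measurable X]setTI; exact: measurable_coord.
Qed.

Lemma lebesgue_cube r : 0 <= r -> lebesgue_rV n (cube r) = ((2 * r) ^+ n)%:E.
Proof.
move=> r0.
have -> : cube r = [set x : 'rV[R]_n | forall j, `[- r, r]%classic (x ord0 j)].
  by apply/seteqP; split => x xr j; have := xr j; rewrite /= in_itv/= ler_norml.
rewrite (@lebesgue_rV_box R n (fun=> `[- r, r]%classic))//.
rewrite (eq_bigr (fun=> (2 * r)%:E)); last first.
  move=> j _; rewrite lebesgue_measure_itv/= lte_fin.
  case: ltP => h; first by rewrite -EFinD opprK mulr_natl mulr2n.
  by congr (_%:E); move: h; lra.
elim: n => [|k IH]; first by rewrite big_ord0.
by rewrite big_ord_recl IH exprS EFinM.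
Qed.

End cutoff.

(** * The energy estimate *)

Section energy.
Context {R : realType}.
Variables (n : nat) (s p : R) (u : 'rV[R]_n -> R).
Hypothesis n0 : (0 < n)%N.
Hypothesis s01 : 0 < s < 1.
Hypothesis u2 : is_Ck 2 u.
Hypothesis uL : Lbar s u.
Hypothesis u0 : forall x, 0 <= u x.
Hypothesis uI : forall x, u x `^ p <= - I_op s u x.
Notation mu := (@lebesgue_measure R).
Notation L := (@lebesgue_rV R n).

Lemma integral_cutoff_le (f : 'rV[R]_n -> R) (B r : R) : 0 < r -> 0 <= B ->
  measurable_fun setT f -> (forall x, 0 <= f x) ->
  (forall x, cube r x -> f x <= B) ->
  (\int[L]_x (f x * cutoff r x)%:E <= (B * (2 * r) ^+ n)%:E)%E.
Proof.
move=> r0 B0 mf f0 fB.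
apply: (@le_trans _ _ (\int[L]_x (B%:E * (\1_(cube r) x)%:E))%E).
  apply: ge0_le_integral => //.
  - by move=> x _; rewrite lee_fin mulr_ge0// cutoff_ge0.
  - apply/measurable_EFinP; apply: measurable_funM => //; exact: measurable_cutoff.
  - apply/measurable_EFinP; apply: measurable_funM => //.
    by apply: measurable_indic; exact: measurable_cube.
  - move=> x _; rewrite -EFinM lee_fin indicE.
    have [xr|xr] := pselect (cube r x).
      by rewrite mem_set// ler_pM ?cutoff_ge0 ?cutoff_le1 ?fB.
    by rewrite cutoff_eq0// memNset// !mulr0.
rewrite ge0_integralZl_EFin//.
- rewrite integral_indic//; last exact: measurable_cube.
  rewrite setIT EFinM [X in (_ * X <= _)%E](_ : _ = ((2 * r) ^+ n)%:E)//.
  exact: (lebesgue_cube (ltW r0)).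
- by apply/measurable_EFinP; apply: measurable_indic; exact: measurable_cube.
Qed.

Let cu : continuous u. Proof. by case: u2. Qed.
Let measurable_u : measurable_fun setT u. Proof. by case: uL => -[]. Qed.
Let mup : measurable_fun setT (fun x => u x `^ p).
Proof. exact: (measurableT_comp (@measurable_powR R p) measurable_u). Qed.

Lemma integral_cutoff_lty r : 0 < r -> (\int[L]_x (u x * cutoff r x)%:E < +oo)%E.
Proof.
move=> r0; have [B B0 hB] := cube_bounded r cu.
apply: (@le_lt_trans _ _ (B * (2 * r) ^+ n)%:E); last by rewrite ltry.
apply: integral_cutoff_le => // x /hB; exact/le_trans/ler_norm.
Qed.

(** Half the normalizing constant, times n directions, times the factor 8 of the
    second difference inequality and the constant of [frac_kernel_min]. *)
Definition energy_const : R := Cs s / 2 * (n%:R * (8 * kernel_const s)).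

Lemma energy_const_ge0 : 0 <= energy_const.
Proof.
by rewrite !mulr_ge0// ?kernel_const_ge0// ?Cs_ge0// invr_ge0.
Qed.

Section fixed_scale.
Variables (r eps : R).
Hypothesis r0 : 0 < r.
Let g := @cutoff R n r.
Let k := tkernel s eps.
Let c := Cs s / 2.
Let X i x := (\int[mu]_t (g x * ((u (x + t *: basis_vec i) +
                u (x - t *: basis_vec i)) * k t))%:E)%E.
Let Y x := (\int[mu]_t (g x * (2 * u x * k t))%:E)%E.
Let H := (\int[L]_x (u x * g x)%:E)%E.

Let c0 : 0 <= c. Proof. by rewrite divr_ge0// Cs_ge0. Qed.
Let g0 x : 0 <= g x. Proof. exact: cutoff_ge0. Qed.
Let mg : measurable_fun setT g. Proof. exact: measurable_cutoff. Qed.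
Let k0 t : 0 <= k t. Proof. exact: tkernel_ge0. Qed.
Let mk : measurable_fun setT k. Proof. exact: measurable_tkernel. Qed.
Let H0 : (0 <= H)%E.
Proof. by apply: integral_ge0 => x _; rewrite lee_fin mulr_ge0. Qed.

Let X0 i x : (0 <= X i x)%E.
Proof. by apply: integral_ge0 => t _; rewrite lee_fin !mulr_ge0// addr_ge0. Qed.

Let Y0 x : (0 <= Y x)%E.
Proof. by apply: integral_ge0 => t _; rewrite lee_fin !mulr_ge0. Qed.

Let XE i x : X i x = ((g x)%:E * \int[mu]_t ((u (x + t *: basis_vec i) +
                u (x - t *: basis_vec i)) * k t)%:E)%E.
Proof.
rewrite /X; under eq_integral do rewrite EFinM.
rewrite ge0_integralZl_EFin//.
- by move=> t _; rewrite lee_fin mulr_ge0// addr_ge0.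
- apply/measurable_EFinP; apply: measurable_funM => //; apply: measurable_funD.
    exact: measurable_line.
  exact: measurable_lineN.
Qed.

Let YE x : Y x = ((g x)%:E * \int[mu]_t (2 * u x * k t)%:E)%E.
Proof.
rewrite /Y; under eq_integral do rewrite EFinM.
rewrite ge0_integralZl_EFin//.
- by move=> t _; rewrite lee_fin !mulr_ge0.
- by apply/measurable_EFinP; apply: measurable_funM.
Qed.

Let mX i : measurable_fun setT (X i).
Proof.
apply: (measurable_fun_fubini_tonelli_F (m2 := mu) (fun z : 'rV[R]_n * R =>
  (g z.1 * ((u (z.1 + z.2 *: basis_vec i) + u (z.1 - z.2 *: basis_vec i)) * k z.2))%:E)).
  apply/measurable_EFinP; apply: measurable_funM.
    exact: measurableT_comp mg measurable_fst.
  apply: measurable_funM; last exact: measurableT_comp mk measurable_snd.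
  apply: measurable_funD; first exact: measurable_translate_pair.
  exact: measurable_translate_pairN.
by move=> z; rewrite lee_fin !mulr_ge0// addr_ge0.
Qed.

Let mY : measurable_fun setT Y.
Proof.
apply: (measurable_fun_fubini_tonelli_F (m2 := mu) (fun z : 'rV[R]_n * R =>
  (g z.1 * (2 * u z.1 * k z.2))%:E)).
  apply/measurable_EFinP; apply: measurable_funM.
    exact: measurableT_comp mg measurable_fst.
  apply: measurable_funM; last exact: measurableT_comp mk measurable_snd.
  by apply: measurable_funM => //; exact: measurableT_comp measurable_u measurable_fst.
by move=> z; rewrite lee_fin !mulr_ge0.
Qed.

(* The truncated operator moved from u to the cutoff, in the direction i; replacing
   the truncated kernel by the full one makes the bound independent of eps. *)
Let YX i : (\int[L]_x Y x <= \int[L]_x X i x +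
  (8 * kernel_const s * r `^ (- (2 * s)))%:E * H)%E.
Proof.
pose d (t : R) := 8 * Num.min 1 ((t / r) ^+ 2).
have md : measurable_fun setT d.
  apply: measurable_funM => //; apply: measurable_minr => //.
  by apply: measurable_funX; exact: measurable_funM.
have d0 t : 0 <= d t by rewrite mulr_ge0// le_min ler01 sqr_ge0.
have := integral_truncated_operator measurable_u mg u0 g0 mk k0 md d0
  (cutoff_second_difference r i).
move=> /le_trans; apply; apply: leeD2l; apply: lee_wpmul2r => //.
apply: (@le_trans _ _ (\int[mu]_t (8%:E * (Num.min 1 ((t / r) ^+ 2) * frac_kernel s t)%:E))%E).
  apply: ge0_le_integral => //.
  - by move=> t _; rewrite lee_fin mulr_ge0.
  - by apply/measurable_EFinP; exact: measurable_funM.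
  - apply/measurable_EFinP; apply: measurable_funM => //; apply: measurable_funM.
      apply: measurable_minr => //.
      by apply: measurable_funX; exact: measurable_funM.
    exact: measurable_frac_kernel.
  - move=> t _; rewrite -EFinM lee_fin /d -!mulrA ler_wpM2l// ler_wpM2l//.
      by rewrite le_min ler01 sqr_ge0.
    exact: tkernel_le.
rewrite ge0_integralZl_EFin//; last 2 first.
- by move=> t _; rewrite lee_fin mulr_ge0 ?frac_kernel_ge0// le_min ler01 sqr_ge0.
- apply/measurable_EFinP; apply: measurable_funM; last exact: measurable_frac_kernel.
  apply: measurable_minr => //.
  by apply: measurable_funX; exact: measurable_funM.
by rewrite -mulrA EFinM lee_wpmul2l//; exact: frac_kernel_min.
Qed.

Let Yfin : 0 < eps <= 1 -> (\int[L]_x Y x < +oo)%E.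
Proof.
move=> eps01.
have -> : (\int[L]_x Y x =
    \int[L]_x ((2 * (u x * g x))%:E * \int[mu]_t (1 * k t)%:E))%E.
  apply: eq_integral => x _; rewrite YE.
  under eq_integral do rewrite EFinM.
  rewrite ge0_integralZl_EFin// ?mulr_ge0//.
  - rewrite muleA -EFinM; congr (_ * _)%E; first by congr EFin; ring.
    by apply: eq_integral => t _; rewrite mul1r.
  - by move=> t _; rewrite lee_fin.
  - exact/measurable_EFinP.
have ik := integrable_fin_num measurableT (integrable_cst_tkernel s01 1 eps01).
have m0 : (0 <= \int[mu]_t (1 * k t)%:E)%E.
  by apply: integral_ge0 => t _; rewrite lee_fin mulr_ge0.
rewrite ge0_integralZr//; last 2 first.
- by apply/measurable_EFinP; apply: measurable_funM => //; exact: measurable_funM.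
- by move=> x _; rewrite lee_fin !mulr_ge0.
under eq_integral do rewrite EFinM.
rewrite ge0_integralZl_EFin//; last 2 first.
- by move=> x _; rewrite lee_fin mulr_ge0.
- by apply/measurable_EFinP; exact: measurable_funM.
have Hf : H \is a fin_num by rewrite ge0_fin_numE//; exact: integral_cutoff_lty.
rewrite -/H -(fineK Hf) /k -(fineK ik) -!EFinM; exact: ltry.
Qed.

(** The truncated inequality is multiplied by the cutoff and integrated.  The
    terms with the translates of u, grouped in Z below, appear on both sides once
    [YX] is used; Z is finite because the truncated kernel is integrable, and can
    be cancelled. *)
Lemma cutoff_energy_delta delta : 0 < delta -> 0 < eps <= 1 ->
  (forall x, cube r x ->
  ((u x `^ p)%:E + (Cs s / 2)%:E * \sum_(i < n)
     \int[mu]_t ((u (x + t *: basis_vec i) + u (x - t *: basis_vec i))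
                 * tkernel s eps t)%:E <=
   (Cs s / 2)%:E * \sum_(i < n) \int[mu]_t (2 * u x * tkernel s eps t)%:E
   + delta%:E)%E) ->
  (\int[L]_x (u x `^ p * cutoff r x)%:E <=
   (energy_const * r `^ (- (2 * s)))%:E * H + (delta * (2 * r) ^+ n)%:E)%E.
Proof.
move=> d0 eps01 h.
have ptw x : ((u x `^ p * g x)%:E + c%:E * (\sum_(i < n) X i x) <=
   c%:E * (\sum_(i < n) Y x) + (delta * g x)%:E)%E.
  have [xr|xr] := pselect (cube r x); last first.
    rewrite (_ : g x = 0); last exact: cutoff_eq0.
    rewrite !mulr0 add0e adde0 big1; first by rewrite mule0 mule_ge0// sume_ge0.
    by move=> i _; rewrite XE (_ : g x = 0) ?mul0e//; exact: cutoff_eq0.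
  have gx : (0 <= (g x)%:E)%E by rewrite lee_fin.
  have := lee_wpmul2l gx (h x xr).
  rewrite ge0_muleDr; last 2 first.
  - by rewrite lee_fin powR_ge0.
  - rewrite mule_ge0// sume_ge0// => i _; apply: integral_ge0 => t _.
    by rewrite lee_fin mulr_ge0// addr_ge0.
  rewrite ge0_muleDr; last 2 first.
  - rewrite mule_ge0// sume_ge0// => i _; apply: integral_ge0 => t _.
    by rewrite lee_fin !mulr_ge0.
  - by rewrite lee_fin ltW.
  rewrite !(muleCA (g x)%:E) -!EFinM ![g x * _]mulrC.
  have -> : ((g x)%:E * \sum_(i < n) \int[mu]_t ((u (x + t *: basis_vec i) +
      u (x - t *: basis_vec i)) * k t)%:E = \sum_(i < n) X i x)%E.
    rewrite ge0_sume_distrr; first by apply: eq_bigr => i _; rewrite XE.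
    by move=> i _; apply: integral_ge0 => t _; rewrite lee_fin mulr_ge0// addr_ge0.
  have -> : ((g x)%:E * \sum_(i < n) \int[mu]_t (2 * u x * k t)%:E =
      \sum_(i < n) Y x)%E.
    rewrite ge0_sume_distrr; first by apply: eq_bigr => i _; rewrite YE.
    by move=> i _; apply: integral_ge0 => t _; rewrite lee_fin !mulr_ge0.
  by [].
have mS (F : 'I_n -> 'rV[R]_n -> \bar R) : (forall i, measurable_fun setT (F i)) ->
    (forall i x, (0 <= F i x)%E) ->
    (\int[L]_x (c%:E * \sum_(i < n) F i x) = c%:E * \sum_(i < n) \int[L]_x F i x)%E.
  move=> mF F0; rewrite ge0_integralZl_EFin//.
  - by rewrite ge0_integral_sum.
  - by move=> x _; apply: sume_ge0.
  - exact: emeasurable_sum.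
have mug : measurable_fun setT (fun x => (u x `^ p * g x)%:E).
  by apply/measurable_EFinP; exact: measurable_funM.
have mdg : measurable_fun setT (fun x => (delta * g x)%:E).
  by apply/measurable_EFinP; exact: measurable_funM.
have mSX : measurable_fun setT (fun x => c%:E * \sum_(i < n) X i x)%E.
  by apply: emeasurable_funM => //; exact: emeasurable_sum.
have mSY : measurable_fun setT (fun x => c%:E * \sum_(i < n) Y x)%E.
  by apply: emeasurable_funM => //; exact: emeasurable_sum.
have pug x : (0 <= (u x `^ p * g x)%:E)%E by rewrite lee_fin mulr_ge0// powR_ge0.
have pdg x : (0 <= (delta * g x)%:E)%E by rewrite lee_fin mulr_ge0// ltW.
have pSX x : (0 <= c%:E * \sum_(i < n) X i x)%E by rewrite mule_ge0// sume_ge0.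
have pSY x : (0 <= c%:E * \sum_(i < n) Y x)%E by rewrite mule_ge0// sume_ge0.
have : (\int[L]_x ((u x `^ p * g x)%:E + c%:E * (\sum_(i < n) X i x)) <=
   \int[L]_x (c%:E * (\sum_(i < n) Y x) + (delta * g x)%:E))%E.
  apply: ge0_le_integral => //.
  - by move=> x _; rewrite adde_ge0.
  - exact: emeasurable_funD.
  - exact: emeasurable_funD.
rewrite ge0_integralD// ge0_integralD// mS// (mS (fun=> Y))//.
have V : (\int[L]_x (delta * g x)%:E <= (delta * (2 * r) ^+ n)%:E)%E.
  have delta0 := ltW d0.
  by apply: (@integral_cutoff_le (fun=> delta)).
set A := (\int[L]_x (u x `^ p * g x)%:E)%E.
have A0 : (0 <= A)%E by exact: integral_ge0.
set Z := (c%:E * \sum_(i < n) \int[L]_x X i x)%E.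
have Z0 : (0 <= Z)%E by rewrite mule_ge0// sume_ge0// => i _; exact: integral_ge0.
move=> AZ.
have AZ' := le_trans AZ (leeD2l _ V).
have Zfin : Z \is a fin_num.
  rewrite ge0_fin_numE//; apply: (le_lt_trans (leeDr Z A0)).
  apply: (le_lt_trans AZ'); rewrite lte_add_pinfty ?ltry//.
  rewrite lte_mul_pinfty//; apply: lte_sum_pinfty => i _; exact: Yfin.
have YZ : (c%:E * \sum_(i < n) \int[L]_x Y x <=
    Z + (energy_const * r `^ (- (2 * s)))%:E * H)%E.
  apply: (@le_trans _ _ (c%:E * \sum_(i < n) (\int[L]_x X i x +
       (8 * kernel_const s * r `^ (- (2 * s)))%:E * H))%E).
    by apply: lee_wpmul2l => //; apply: lee_sum => i _; exact: YX.
  have kr0 : (0 <= (8 * kernel_const s * r `^ (- (2 * s)))%:E * H)%E.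
    by rewrite mule_ge0// lee_fin !mulr_ge0 ?powR_ge0// kernel_const_ge0.
  rewrite big_split/= ge0_muleDr; last 2 first.
  - by apply: sume_ge0 => i _; exact: integral_ge0.
  - by apply: sume_ge0.
  apply: leeD2l; rewrite -ge0_sume_distrl; last first.
    by move=> i _; rewrite lee_fin !mulr_ge0 ?powR_ge0// kernel_const_ge0.
  rewrite sumEFin muleA -EFinM sumr_const card_ord -[X in (_ * X)%:E]mulr_natl.
  by rewrite /energy_const !mulrA.
have AZ2 := le_trans AZ' (leeD2r _ YZ).
by rewrite -(leeD2lE _ _ Zfin) addeC addeA.
Qed.

End fixed_scale.

(** The error delta of the truncation is multiplied by at most the volume of the
    cube, hence can be made arbitrarily small. *)
Lemma cutoff_energy r : 0 < r ->
  (\int[L]_x (u x `^ p * cutoff r x)%:E <=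
   (energy_const * r `^ (- (2 * s)))%:E * \int[L]_x (u x * cutoff r x)%:E)%E.
Proof.
move=> r0; apply/lee_addgt0Pr => e e0.
have V0 : 0 < (2 * r) ^+ n by rewrite exprn_gt0// mulr_gt0.
have d0 : 0 < e / (2 * r) ^+ n by rewrite divr_gt0.
have [eps [eps01 h]] := truncated_inequality n0 s01 u2 uL u0 uI (ltW r0) d0.
have := cutoff_energy_delta r0 d0 eps01 h.
by rewrite divfK ?gt_eqF.
Qed.

End energy.

(** * The Liouville argument *)

Section liouville.
Context {R : realType}.

(** Either the left-hand side is below gamma r^(-N), or v > (gamma/K) r^(2s-N);
    in the second case ((K/gamma) v)^(p-1) >= r^((2s-N)(p-1)) >= r^(-2s), the last
    step being the condition on the exponent p together with r >= 1. *)
Lemma scaled_young (N s p K gamma r v : R) : 1 < p ->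
  (N - 2 * s) * (p - 1) <= 2 * s -> 0 <= K -> 0 < gamma -> 1 <= r -> 0 <= v ->
  K * r `^ (- (2 * s)) * v <=
  K * (K / gamma) `^ (p - 1) * v `^ p + gamma * r `^ (- N).
Proof.
move=> p1 crit K0 g0 r1 v0.
have r0 : 0 < r by apply: lt_le_trans r1.
have p10 : 0 < p - 1 by rewrite subr_gt0.
have p0 : 0 < p by apply: lt_trans p1.
have [h|h] := leP (K * r `^ (- (2 * s)) * v) (gamma * r `^ (- N)).
  by apply: (le_trans h); rewrite lerDr !mulr_ge0 ?powR_ge0.
have h1 : r `^ (2 * s - N) <= K / gamma * v.
  rewrite mulrAC ler_pdivlMr// mulrC.
  rewrite -(ler_pM2r (powR_gt0 (- (2 * s)) r0)) -mulrA -powRD; last first.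
    by rewrite (gt_eqF r0) implybT.
  by rewrite addrAC subrr add0r mulrAC ltW.
have h2 : r `^ (- (2 * s)) <= (K / gamma) `^ (p - 1) * v `^ (p - 1).
  rewrite -powRM//; last by rewrite divr_ge0// ltW.
  apply: (@le_trans _ _ ((r `^ (2 * s - N)) `^ (p - 1))).
    by rewrite -powRrM ler_powR// lerNl -mulNr opprB.
  apply: ge0_ler_powR h1; rewrite ?nnegrE ?powR_ge0 ?(ltW p10)//.
  by rewrite mulr_ge0// divr_ge0// ltW.
apply: (@le_trans _ _ (K * (K / gamma) `^ (p - 1) * v `^ p)); last first.
  by rewrite lerDl mulr_ge0 ?powR_ge0// ltW.
rewrite -(mulr_powRB1 v0 p0) -!mulrA ler_wpM2l// [v * _]mulrC mulrA ler_wpM2r//.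
Qed.

Variables (n : nat) (s p : R) (u : 'rV[R]_n -> R).
Hypothesis n0 : (0 < n)%N.
Hypothesis s01 : 0 < s < 1.
Hypothesis p1 : 1 < p.
Hypothesis crit : (n%:R - 2 * s) * (p - 1) <= 2 * s.
Hypothesis u2 : is_Ck 2 u.
Hypothesis uL : Lbar s u.
Hypothesis u0 : forall x, 0 <= u x.
Hypothesis uI : forall x, u x `^ p <= - I_op s u x.
Notation L := (@lebesgue_rV R n).
Notation K := (@energy_const R n s).

Let cu : continuous u. Proof. by case: u2. Qed.
Let measurable_u : measurable_fun setT u. Proof. by case: uL => -[]. Qed.
Let mup : measurable_fun setT (fun x => u x `^ p).
Proof. exact: (measurableT_comp (@measurable_powR R p) measurable_u). Qed.
Let mupE D : measurable_fun D (fun x => (u x `^ p)%:E).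
Proof. by apply/measurable_funTS/measurable_EFinP. Qed.
Let p0 : 0 < p. Proof. exact: lt_trans p1. Qed.
Let s0 : 0 < s. Proof. by case/andP: s01. Qed.
Let K0 : 0 <= K. Proof. exact: energy_const_ge0. Qed.
Let mcube (r : R) : measurable (cube r : set 'rV[R]_n). Proof. exact: measurable_cube. Qed.

Let F (r : R) := (\int[L]_(x in cube r) (u x `^ p)%:E)%E.

Let pE x : (0 <= (u x `^ p)%:E)%E. Proof. by rewrite lee_fin powR_ge0. Qed.

Let cutoff_volume (r : R) : 0 < r ->
  ((r `^ (- n%:R))%:E * (\int[L]_x (1 * cutoff r x)%:E) <= (2 ^+ n)%:E)%E.
Proof.
move=> r0.
have h := @integral_cutoff_le R n (fun=> 1) 1 r r0 ler01 (@measurable_cst _ _ _ _ _ _) (fun=> ler01) (fun _ _ => lexx 1).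
apply: (le_trans (lee_wpmul2l _ h)); first by rewrite lee_fin powR_ge0.
rewrite -EFinM lee_fin mul1r powR_invn ?(ltW r0)// exprMn mulrCA mulVf ?mulr1//.
by rewrite gt_eqF// exprn_gt0.
Qed.

Lemma energy_le_cutoff (r : R) : 0 < r ->
  (((1 / 2) ^+ n)%:E * F (r / 2)%R <= \int[L]_x (u x `^ p * cutoff r x)%:E)%E.
Proof.
move=> r0; rewrite -ge0_integralZl_EFin//.
apply: (@le_trans _ _ (\int[L]_(x in cube (r / 2)) (u x `^ p * cutoff r x)%:E)%E).
  apply: ge0_le_integral => //.
  - by move=> x _; rewrite mule_ge0// lee_fin.
  - by apply: emeasurable_funM.
  - apply/measurable_funTS/measurable_EFinP/measurable_funM => //.
    exact: measurable_cutoff.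
  - move=> x xr; rewrite -EFinM lee_fin mulrC ler_wpM2l ?powR_ge0//.
    exact: cutoff_half.
apply: ge0_subset_integral => //.
  by apply/measurable_EFinP/measurable_funM => //; exact: measurable_cutoff.
by move=> x _; rewrite lee_fin mulr_ge0 ?powR_ge0 ?cutoff_ge0.
Qed.

Let A (r : R) := (\int[L]_x (u x `^ p * cutoff r x)%:E)%E.

Let A0 r : (0 <= A r)%E.
Proof. by apply: integral_ge0 => x _; rewrite lee_fin mulr_ge0 ?powR_ge0 ?cutoff_ge0. Qed.

Let A_fin (r : R) : 0 < r -> A r \is a fin_num.
Proof.
move=> r0; rewrite ge0_fin_numE//.
have [B B0 hB] := cube_bounded r cu.
apply: (@le_lt_trans _ _ (B `^ p * (2 * r) ^+ n)%:E); last by rewrite ltry.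
apply: integral_cutoff_le => //; first by rewrite powR_ge0.
move=> x xr; apply: ge0_ler_powR; rewrite ?nnegrE ?(ltW p0)//.
exact: le_trans (ler_norm _) (hB x xr).
Qed.

Let A_le_scaled (r : R) : 0 < r ->
  (A r <= \int[L]_x (K * r `^ (- (2 * s)) * u x * cutoff r x)%:E)%E.
Proof.
move=> r0; apply: (le_trans (cutoff_energy n0 s01 u2 uL u0 uI r0)).
rewrite -ge0_integralZl_EFin//.
- by under eq_integral do rewrite -EFinM mulrA.
- by move=> x _; rewrite lee_fin mulr_ge0 ?cutoff_ge0.
- by apply/measurable_EFinP/measurable_funM => //; exact: measurable_cutoff.
- by rewrite mulr_ge0// powR_ge0.
Qed.

Let measurable_cutoff_term (f : 'rV[R]_n -> R) (r c : R) : measurable_fun setT f ->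
  measurable_fun setT (fun x => (c * f x * cutoff r x)%:E).
Proof.
move=> mf; apply/measurable_EFinP/measurable_funM; last exact: measurable_cutoff.
exact: measurable_funM.
Qed.

Let integral_cst_cutoff (r c : R) : 0 < r -> 0 <= c ->
  (\int[L]_x (c * r `^ (- n%:R) * cutoff r x)%:E <= (c * 2 ^+ n)%:E)%E.
Proof.
move=> r0 c0; rewrite (eq_integral (fun x : 'rV[R]_n =>
    (c * r `^ (- n%:R))%:E * (1 * cutoff r x)%:E)%E); last first.
  by move=> x _; rewrite mul1r -EFinM.
rewrite ge0_integralZl_EFin//.
- by rewrite EFinM -muleA EFinM lee_wpmul2l// ?cutoff_volume// lee_fin.
- by move=> x _; rewrite lee_fin mul1r cutoff_ge0.
- by apply/measurable_EFinP/measurable_funM => //; exact: measurable_cutoff.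
- by rewrite mulr_ge0// powR_ge0.
Qed.

Let scaled_term_ge0 (r : R) x : 0 <= K * r `^ (- (2 * s)) * u x * cutoff r x.
Proof. by rewrite mulr_ge0 ?cutoff_ge0// mulr_ge0// mulr_ge0// powR_ge0. Qed.

(** With gamma large the coefficient of u^p in [scaled_young] is at most 1/2 and
    the resulting term is absorbed; the rest is bounded because the weight r^(-n)
    compensates the volume of the support. *)
Lemma energy_bounded : exists M : R, forall r, 1 <= r -> (A r <= M%:E)%E.
Proof.
have p10 : 0 < p - 1 by rewrite subr_gt0.
have h2 : 0 < 1 / 2 :> R by [].
have [e /andP[e0 e1] Ke] := powR_small K p10 ltr01 h2.
(* K + 1 rather than K keeps gamma positive; then K / gamma <= e *)
pose gamma := (K + 1) / e.
have K1 : 0 < K + 1 by rewrite ltr_wpDl.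
have g0 : 0 < gamma by rewrite divr_gt0.
pose Gam := K * (K / gamma) `^ (p - 1).
have Gam0 : 0 <= Gam by rewrite mulr_ge0// powR_ge0.
have Gam2 : Gam <= 1 / 2.
  apply: le_trans Ke; rewrite ler_wpM2l//.
  apply: ge0_ler_powR; rewrite ?nnegrE ?(ltW p10) ?(ltW e0)//.
    by rewrite divr_ge0// ltW.
  rewrite /gamma invf_div mulrA ler_pdivrMr// mulrC ler_wpM2l ?(ltW e0)//.
  by rewrite lerDl.
exists (2 * (gamma * 2 ^+ n)) => r r1.
have r0 : 0 < r by apply: lt_le_trans r1.
have h : (A r <= Gam%:E * A r + (gamma * 2 ^+ n)%:E)%E.
  apply: (le_trans (A_le_scaled r0)).
  apply: (@le_trans _ _ (\int[L]_x ((Gam * u x `^ p * cutoff r x)%:E +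
      (gamma * r `^ (- n%:R) * cutoff r x)%:E))%E).
    apply: ge0_le_integral => //.
    - by move=> x _; rewrite lee_fin scaled_term_ge0.
    - exact: measurable_cutoff_term.
    - apply: emeasurable_funD; first exact: measurable_cutoff_term.
      apply/measurable_EFinP/measurable_funM => //; exact: measurable_cutoff.
    - move=> x _; rewrite -EFinD lee_fin -mulrDl ler_wpM2r ?cutoff_ge0//.
      exact: scaled_young.
  rewrite ge0_integralD//; last 4 first.
  - by move=> x _; rewrite lee_fin mulr_ge0 ?cutoff_ge0// mulr_ge0 ?powR_ge0.
  - exact: measurable_cutoff_term.
  - by move=> x _; rewrite lee_fin mulr_ge0 ?cutoff_ge0// mulr_ge0 ?powR_ge0// ltW.
  - apply/measurable_EFinP/measurable_funM => //; exact: measurable_cutoff.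
  apply: leeD; last by apply: integral_cst_cutoff => //; exact: ltW.
  rewrite -ge0_integralZl_EFin//.
  - by under [X in (_ <= X)%E]eq_integral do rewrite -EFinM mulrA.
  - by move=> x _; rewrite lee_fin mulr_ge0 ?powR_ge0 ?cutoff_ge0.
  - apply/measurable_EFinP/measurable_funM => //; exact: measurable_cutoff.
move: h; rewrite -(fineK (A_fin r0)) -EFinM -EFinD !lee_fin.
have : 0 <= fine (A r) by rewrite fine_ge0.
move: (fine _) => a a0 h; rewrite mulr_natl mulr2n.
have : Gam * a <= 1 / 2 * a by rewrite ler_wpM2r.
lra.
Qed.

(** On the fixed cube u is bounded and the factor r^(-2s) makes its contribution
    small as r grows; outside, [scaled_young] is used, and there the coefficient of
    u^p, which is large when gamma is small, multiplies only the tail of the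
    integral of u^p. *)
Lemma energy_split (gamma rho : R) : 0 < gamma -> 0 < rho ->
  exists2 D : R, 0 <= D & forall r, 1 <= r ->
   (A r <= (D * r `^ (- (2 * s)))%:E
     + (K * (K / gamma) `^ (p - 1))%:E * \int[L]_(x in ~` cube rho) (u x `^ p)%:E
     + (gamma * 2 ^+ n)%:E)%E.
Proof.
move=> g0 rho0; have [B B0 hB] := cube_bounded rho cu.
pose Gam := K * (K / gamma) `^ (p - 1).
have Gam0 : 0 <= Gam by rewrite mulr_ge0// powR_ge0.
exists (K * B * (2 * rho) ^+ n) => [|r r1].
  by apply: mulr_ge0; [exact: mulr_ge0|rewrite exprn_ge0// mulr_ge0// ltW].
have r0 : 0 < r by apply: lt_le_trans r1.
have Kr0 : 0 <= K * r `^ (- (2 * s)) by rewrite mulr_ge0// powR_ge0.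
have KrB0 : 0 <= K * r `^ (- (2 * s)) * B by rewrite mulr_ge0.
apply: (le_trans (A_le_scaled r0)).
have m1 : measurable_fun setT (fun x : 'rV[R]_n =>
    (K * r `^ (- (2 * s)) * B)%:E * (\1_(cube rho) x)%:E)%E.
  by apply: emeasurable_funM => //; apply/measurable_EFinP/measurable_indic.
have m2 : measurable_fun setT (fun x : 'rV[R]_n =>
    Gam%:E * ((fun x => (u x `^ p)%:E) \_ (~` cube rho)) x)%E.
  apply: emeasurable_funM => //.
  by apply/(measurable_restrictT (fun x => (u x `^ p)%:E) (measurableC (mcube rho))).
have m3 : measurable_fun setT (fun x : 'rV[R]_n => (gamma * r `^ (- n%:R) * cutoff r x)%:E).
  apply/measurable_EFinP/measurable_funM => //; exact: measurable_cutoff.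
have p1' x : (0 <= (K * r `^ (- (2 * s)) * B)%:E * (\1_(cube rho) x)%:E)%E.
  by rewrite mule_ge0// lee_fin.
have p2' x : (0 <= Gam%:E * ((fun x => (u x `^ p)%:E) \_ (~` cube rho)) x)%E.
  by rewrite mule_ge0// patchE; case: ifP.
have p3' x : (0 <= (gamma * r `^ (- n%:R) * cutoff r x)%:E)%E.
  by rewrite lee_fin mulr_ge0 ?cutoff_ge0// mulr_ge0 ?powR_ge0// ltW.
apply: (@le_trans _ _ (\int[L]_x ((K * r `^ (- (2 * s)) * B)%:E * (\1_(cube rho) x)%:E +
    Gam%:E * ((fun x => (u x `^ p)%:E) \_ (~` cube rho)) x +
    (gamma * r `^ (- n%:R) * cutoff r x)%:E))%E).
  apply: ge0_le_integral => //.
  - by move=> x _; rewrite lee_fin scaled_term_ge0.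
  - exact: measurable_cutoff_term.
  - by apply: emeasurable_funD => //; exact: emeasurable_funD.
  - move=> x _; rewrite indicE patchE.
    have c0 := @cutoff_ge0 R n r x; have c1 := @cutoff_le1 R n r x.
    have [xr|xr] := pselect (cube rho x).
      rewrite mem_set// ifF; last by apply/negbTE; rewrite in_setC mem_set.
      rewrite mule0 adde0 mule1 -EFinD lee_fin.
      apply: (@le_trans _ _ (K * r `^ (- (2 * s)) * B)).
        rewrite -[leRHS]mulr1; apply: ler_pM => //; first by rewrite mulr_ge0.
        by rewrite ler_wpM2l// (le_trans (ler_norm _) (hB x xr)).
      by rewrite lerDl mulr_ge0// mulr_ge0 ?powR_ge0// ltW.
    rewrite memNset// ifT; last by rewrite in_setC memNset.
    rewrite mule0 add0e -EFinM -EFinD lee_fin.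
    apply: (@le_trans _ _ ((Gam * u x `^ p + gamma * r `^ (- n%:R)) * cutoff r x)).
      by rewrite ler_wpM2r//; exact: scaled_young.
    rewrite mulrDl lerD2r -[leRHS]mulr1 ler_wpM2l//.
    by rewrite mulr_ge0// powR_ge0.
rewrite ge0_integralD//; last 2 first.
- by move=> x _; rewrite adde_ge0.
- exact: emeasurable_funD.
apply: leeD; last by apply: integral_cst_cutoff => //; exact: ltW.
rewrite ge0_integralD//; apply: leeD.
  rewrite ge0_integralZl_EFin//; last by apply/measurable_EFinP/measurable_indic.
  rewrite integral_indic// setIT [X in (_ * X <= _)%E](_ : _ = ((2 * rho) ^+ n)%:E); last first.
    exact: (lebesgue_cube (ltW rho0)).
  by rewrite -EFinM lee_fin [K * _ * B]mulrAC [leLHS]mulrAC.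
rewrite ge0_integralZl_EFin//; last 2 first.
- by move=> x _; rewrite patchE; case: ifP.
- by apply/(measurable_restrictT (fun x => (u x `^ p)%:E) (measurableC (mcube rho))).
by rewrite -integral_mkcond.
Qed.

Let total := (\int[L]_x (u x `^ p)%:E)%E.
Let T (r : R) := (\int[L]_(x in ~` cube r) (u x `^ p)%:E)%E.

Let F_le (a b : R) : a <= b -> (F a <= F b)%E.
Proof.
move=> ab; apply: ge0_subset_integral => // x xa j.
exact: le_trans (xa j) ab.
Qed.

Let half_energy (r : R) (m : R) : 0 < r ->
  (\int[L]_x (u x `^ p * cutoff r x)%:E <= m%:E)%E -> (F (r / 2) <= (2 ^+ n * m)%:E)%E.
Proof.
move=> r0 /(le_trans (energy_le_cutoff r0)) h.
have c0 : (0 <= (2 ^+ n : R)%:E)%E by rewrite lee_fin exprn_ge0.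
have := lee_wpmul2l c0 h.
by rewrite muleA -!EFinM -exprMn mulrCA mul1r mulfV ?expr1n ?mul1e.
Qed.

Let F_cvg : F i.+1%:R @[i --> \oo] --> total.
Proof.
have -> : total = (\int[L]_(x in \bigcup_i (cube i.+1%:R)) (u x `^ p)%:E)%E.
  congr (integral _ _ _); apply/seteqP; split => // x _.
  exists (Num.truncn (enorm x)) => // j.
  by apply: (le_trans (cube_enorm x j)); exact/ltW/truncnS_gt.
apply: ge0_nondecreasing_set_cvg_integral => //.
move=> i j ij; apply/subsetPset => x xi k; apply: (le_trans (xi k)).
by rewrite ler_nat ltnS.
Qed.

Let total_le (m : \bar R) : (forall i : nat, (F i.+1%:R <= m)%E) -> (total <= m)%E.
Proof.
move=> h; have /cvg_lim <- // := F_cvg.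
apply: lime_le; first by apply/cvg_ex; exists total; exact: F_cvg.
exact: nearW.
Qed.

Let total_fin : total \is a fin_num.
Proof.
rewrite ge0_fin_numE; last by apply: integral_ge0.
have [M hM] := energy_bounded.
apply: (@le_lt_trans _ _ (2 ^+ n * M)%:E); last by rewrite ltry.
apply: total_le => i.
have r1 : 1 <= i.+1%:R * 2 :> R by rewrite -natrM ler1n muln_gt0.
have := half_energy (lt_le_trans ltr01 r1) (hM _ r1).
by rewrite mulfK.
Qed.

Let tail_small (e : R) : 0 < e -> exists2 rho : R, 0 < rho & (T rho <= e%:E)%E.
Proof.
move=> e0; apply: contrapT => h.
have TF (i : nat) : (e%:E + F i.+1%:R <= total)%E.
  have -> : total = (F i.+1%:R + T i.+1%:R)%E.
    rewrite /total -(setUv (cube i.+1%:R)) ge0_integral_setU//.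
    - exact: measurableC.
    - exact/disj_setPCl.
  rewrite [leLHS]addeC; apply: leeD2l; rewrite leNgt; apply/negP => Te.
  by apply: h; exists i.+1%:R => //; exact: ltW.
have : (total <= total - e%:E)%E.
  by apply: total_le => i; rewrite leeBrDr// addeC.
by rewrite -(fineK total_fin) -EFinB lee_fin; lra.
Qed.

(** In [energy_split] gamma is fixed first, then rho so large that the tail of
    the finite integral of u^p is small compared with the coefficient in front of
    it, and finally r = 1/eps.  Each of the three terms contributes d; the factor
    2^n is the loss in [energy_le_cutoff]. *)
Lemma energy_le_small (sigma tau : R) : 0 < sigma -> 0 < tau -> (F sigma <= tau%:E)%E.
Proof.
move=> sig0 tau0.
have c0 : 0 < 2 ^+ n :> R by rewrite exprn_gt0.
pose d := tau / (3 * 2 ^+ n).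
have d0 : 0 < d by rewrite divr_gt0// mulr_gt0.
pose gamma := d / 2 ^+ n.
have g0 : 0 < gamma by rewrite divr_gt0.
pose Gam := K * (K / gamma) `^ (p - 1).
have Gam0 : 0 <= Gam by rewrite mulr_ge0// powR_ge0.
have G1 : 0 < Gam + 1 by rewrite ltr_wpDl.
have [rho rho0 Trho] := tail_small (divr_gt0 d0 G1).
have [D D0 hD] := energy_split g0 rho0.
have s20 : 0 < 2 * s by rewrite mulr_gt0.
have b0 : 0 < Num.min 1 (2 * sigma)^-1 by rewrite lt_min ltr01 invr_gt0 mulr_gt0.
have [eps /andP[e0 eb] De] := powR_small D s20 b0 d0.
have [e1 es] : eps <= 1 /\ eps <= (2 * sigma)^-1.
  by move: eb; rewrite le_min => /andP[].
have r1 : 1 <= eps^-1 by rewrite invf_ge1.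
have r0 : 0 < eps^-1 by rewrite invr_gt0.
have sr : sigma <= eps^-1 / 2.
  by rewrite ler_pdivlMr// mulrC -[leLHS]invrK lef_pV2// posrE invr_gt0 mulr_gt0.
apply: (le_trans (F_le sr)).
rewrite (_ : tau = 2 ^+ n * (d + d + d)); last by rewrite /d; field; exact: lt0r_neq0.
apply: half_energy => //; apply: (le_trans (hD _ r1)).
rewrite EFinD; apply: leeD; last by rewrite lee_fin /gamma divfK ?gt_eqF.
rewrite EFinD; apply: leeD.
  rewrite lee_fin (_ : eps^-1 `^ (- (2 * s)) = eps `^ (2 * s))//.
  by rewrite -(powR_inv1 (ltW e0)) -powRrM mulN1r opprK.
apply: (le_trans (lee_wpmul2l _ Trho)); first by rewrite lee_fin.
rewrite -EFinM lee_fin -/Gam mulrCA ler_piMr ?(ltW d0)//.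
by rewrite ler_pdivrMr// mul1r lerDl.
Qed.

(** If u x were positive, u would be at least u x / 2 on a small cube near x by
    continuity, and the integral of u^p over it would be positive. *)
Lemma supersolution_eq0 x : u x = 0.
Proof.
apply/eqP; rewrite eq_le u0 andbT leNgt; apply/negP => ux.
have ux2 : 0 < u x / 2 by rewrite divr_gt0.
have : \forall y \near x, u x / 2 < u y.
  have := @cu x; move/cvgrPdist_lt => /(_ _ ux2); apply: filterS => y.
  by rewrite ltr_distlC => /andP[+ _]; rewrite {1}[u x]splitr addrK.
move=> /nbhs_ballP[d /= d0 hd].
pose Q : set 'rV[R]_n :=
  [set y | forall j, `[x ord0 j, x ord0 j + d / 2]%classic (y ord0 j)].
have mQ : measurable Q.
  rewrite [X in measurable X](_ : _ = \bigcap_(i in [set: 'I_n])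
    ((fun y : 'rV[R]_n => y ord0 i) @^-1` `[x ord0 i, x ord0 i + d / 2])).
    apply: fin_bigcap_measurable => // i _.
    by rewrite -[X in measurable X]setTI; exact: measurable_coord.
  by apply/seteqP; split => [y yQ i _|y yQ i]; [exact: yQ|exact: yQ].
have LQ : L Q = ((d / 2) ^+ n)%:E.
  rewrite (@lebesgue_rV_box R n (fun j => `[x ord0 j, x ord0 j + d / 2]%classic))//.
  rewrite (eq_bigr (fun=> (d / 2)%:E)).
    by elim: (n) => [|k IH]; rewrite ?big_ord0// big_ord_recl IH exprS EFinM.
  move=> j _; rewrite lebesgue_measure_itv/= lte_fin ltrDl divr_gt0//.
  by rewrite -EFinB addrAC subrr add0r.
have Qu y : Q y -> u x / 2 < u y.
  move=> yQ; apply: hd; rewrite /ball /=; split => // i j; rewrite !ord1.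
  have := yQ j; rewrite /= in_itv/= => /andP[y1 y2].
  rewrite /ball /= ltr_norml; apply/andP; split; lra.
pose sigma := enorm x + d.
have sig0 : 0 < sigma by rewrite ltr_wpDl// enorm_ge0.
have Qcube : Q `<=` cube sigma.
  move=> y yQ j; have := yQ j; rewrite /= in_itv/= => /andP[y1 y2].
  have := cube_enorm x j; rewrite /sigma !ler_norml => /andP[x1 x2].
  apply/andP; split; lra.
have v0 : 0 < (u x / 2) `^ p * (d / 2) ^+ n.
  by rewrite mulr_gt0 ?powR_gt0// exprn_gt0// divr_gt0.
have low : (((u x / 2) `^ p * (d / 2) ^+ n)%:E <= F sigma)%E.
  apply: (@le_trans _ _ (\int[L]_(y in Q) (u y `^ p)%:E)%E); last first.
    exact: ge0_subset_integral.
  rewrite EFinM -LQ -integral_cst//; apply: ge0_le_integral => //.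
  - by move=> y _; rewrite lee_fin powR_ge0.
  - move=> y /Qu uy; rewrite lee_fin.
    by apply: ge0_ler_powR; rewrite ?nnegrE ?(ltW p0) ?(ltW ux2)// ltW.
have v20 : 0 < ((u x / 2) `^ p * (d / 2) ^+ n) / 2 by rewrite divr_gt0.
have := le_trans low (energy_le_small sig0 v20).
by rewrite lee_fin; lra.
Qed.

End liouville.

Theorem theorem1p1 (R : realType) (N : nat) (s p : R) (u : 'rV[R]_N -> R) :
  (2 <= N)%N ->
  0 < s < 1 ->
  1 < p <= N%:R / (N%:R - 2 * s) ->
  is_Ck 2 u ->
  Lbar s u ->
  (forall x, 0 <= u x) ->
  (forall x, - I_op s u x >= u x `^ p) ->
  forall x, u x = 0.
Proof.
move=> N2 s01 /andP[p1 pN] u2 uL u0 uI.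
have N0 : (0 < N)%N by exact: ltn_trans N2.
have Ns : 0 < N%:R - 2 * s.
  have : 2 <= N%:R :> R by rewrite ler_nat.
  by case/andP: s01 => _; lra.
apply: (@supersolution_eq0 R N s p u) => //.
move: pN; rewrite ler_pdivlMr//; lra.
Qed.
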